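(* Let $0<q<1$, let $k\ge1$ be an integer, and let $A=C(SU_q(2))$, $T_k,\tilde T_k\in A$, $\mathcal D$, $\mathcal H_h$, $\mathcal N$, $\tilde h$ be as in the context. Then $$sf(T_kT_k^*\mathcal D,\,T_k\mathcal DT_k^* )=-q^4[k]_q,\qquad sf(\tilde T_k\tilde T_k^*\mathcal D,\,\tilde T_k\mathcal D\tilde T_k^* )=-q^2(1-q^2)[k]_q,$$ where $[k]_q:=(1-q^{2k})/(1-q^2)$.
   Context: Algebra. $A=C(SU_q(2))$ is the universal unital $C^*$-algebra generated by $a,b$, $b$ normal, with $a^*a+b^*b=1$, $aa^*+q^2bb^*=1$, $ab=qba$, $ab^*=qb^*a$. It is identified with the $C^*$-algebra of the graph with vertices $v,w$ and edges $\mu:v\to v$, $\nu:v\to w$, $\xi:w\to w$, i.e. the universal $C^*$-algebra generated by orthogonal projections $p_v,p_w$ ($p_v+p_w=1$) and partial isometries $S_\mu,S_\nu,S_\xi$ with $S_\mu^*S_\mu=S_\mu S_\mu^*+S_\nu S_\nu^*=p_v$, $S_\nu^*S_\nu=S_\xi^*S_\xi=S_\xi S_\xi^*=p_w$, via $a=\sum_{k\ge0}(\sqrt{1-q^{2(k+1)}}-\sqrt{1-q^{2k}})(S_\mu+S_\nu)^k(S_\mu^*+S_\nu^* )^{k+1}$, $b=\sum_{k\ge0}q^k(S_\mu+S_\nu)^kS_\xi(S_\mu^*+S_\nu^* )^k$. Put $T_0=p_v$, $T_k=S_\mu^k$ ($k\ge1$); $\tilde T_0=p_w$, $\tilde T_k=S_\mu^{k-1}S_\nu$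 ($k\ge1$); $U_0=p_w$, $U_n=S_\xi^n$, $U_{-n}=S_\xi^{*n}$ ($n\ge1$). $A_c$ is the dense $*$-subalgebra spanned by all $T_kT_l^*$ and $\tilde T_kU_n\tilde T_l^*$. Haar state. $h$ is the Haar state of $SU_q(2)$: it vanishes on polynomials in $a,a^*,b,b^*$ homogeneous of nonzero bidegree ($\deg a=(-1,0)$, $\deg b=(0,1)$), and $h(b^{*n}b^n)=(1-q^2)/(1-q^{2n+2})$. $\mathcal H_h$ is the GNS space, $\langle x,y\rangle=h(x^*y)$. Circle action and module. $\sigma_z$ ($|z|=1$) is the action on $A$ with $\sigma_z(S_\mu)=zS_\mu$, $\sigma_z(S_\nu)=zS_\nu$, $\sigma_z(S_\xi)=S_\xi$. $F$ is its fixed point algebra, $\Phi_m(x)=\frac1{2\pi}\int_0^{2\pi}e^{-im\theta}\sigma_{e^{i\theta}}(x)\,d\theta$, $\Phi=\Phi_0$. $X$ is the right Hilbert $F$-module obtained by completing $A$ for $(x|y)_F=\Phi(x^*y)$, $X_c$ the image of $A_c$, $\Theta_{x,y}z=x(y|z)_F$, and $\operatorname{End}_F^{00}(X_c)$ the span of $\Theta_{x,y}$, $x,y\in X_c$; these and the $\Phi_m$ extend to bounded operators on $\mathcal H_h$. $\mathcal D=\sum_m m\Phi_m$ is a self-adjoint operator on $\mathcal H_h$. $\mathcal N=(\operatorname{End}_F^{00}(X_c))''$ on $\mathcal H_h$, and $\tilde h$ is the faithful normal semifinite trace on $\mathcal N$ with $\tilde h(\Theta_{x,y})=h(y^*x)$,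 given on positive $V$ by $\tilde h(V)=\langle1,V1\rangle+\sum_{m\ge1}(\langle T_m,VT_m\rangle+\langle\tilde T_m,V\tilde T_m\rangle+\langle T_m^*,VT_m^*\rangle+\langle\tilde T_m^*,V\tilde T_m^*\rangle)$. Spectral flow: for $x=T_k$ or $\tilde T_k$, $xx^*\mathcal D$ and $x\mathcal Dx^*$ are operators on $xx^*\mathcal H_h$, and $sf$ is the semifinite spectral flow in $xx^*\mathcal Nxx^*$ with respect to $\tilde h$ along the straight line path; equivalently, if $P_a,P_b$ are the non-negative spectral projections of the initial and final operators, it is the Breuer–Fredholm index of $P_aP_b:\operatorname{ran}P_b\to\operatorname{ran}P_a$. *)

(* Defs.v *)
From HB Require Import structures.
From mathcomp Require Import all_boot all_order all_algebra.
From mathcomp Require Import complex.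
From mathcomp Require Import all_classical all_reals all_analysis.

Set Implicit Arguments.
Unset Strict Implicit.
Unset Printing Implicit Defensive.

Import Order.TTheory GRing.Theory Num.Theory.
Import numFieldNormedType.Exports.

Local Open Scope classical_set_scope.
Local Open Scope ring_scope.
Local Open Scope complex_scope.

(* Unital C*-algebras. The norm is a field of the mixin because the library has
   no structure joining the algebra and the normed module hierarchies; it is
   real-valued. The zero algebra is excluded (algType is nontrivial). *)
HB.mixin Record isCStar (R : realType) A of GRing.Algebra R[i] A := {
  star : A -> A;
  cnorm : A -> R;
  starK : involutive star;
  starD : forall x y, star (x + y) = star x + star y;
  starZ : forall (c : R[i]) x, star (c *: x) = Num.conj c *: star x;
  starM : forall x y, star (x * y) = star y * star x;
  cnorm0_eq0 : forall x, cnorm x = 0 -> x = 0;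
  ler_cnormD : forall x y, cnorm (x + y) <= cnorm x + cnorm y;
  cnormZ : forall (c : R[i]) x, cnorm (c *: x) = complex.Re `|c| * cnorm x;
  ler_cnormM : forall x y, cnorm (x * y) <= cnorm x * cnorm y;
  cnorm_star : forall x, cnorm (star x * x) = cnorm x ^+ 2;
  cnorm_complete : forall u : nat -> A,
    (forall e : R, 0 < e -> exists N, forall m n,
       (N <= m)%N -> (N <= n)%N -> cnorm (u m - u n) < e) ->
    exists x, cnorm (u n - x) @[n --> \oo] --> 0
}.

#[short(type="cstarAlgType")]
HB.structure Definition CStar (R : realType) :=
  {A of isCStar R A & GRing.Algebra R[i] A}.

Section CStarAlgebras.
Context {R : realType}.
Implicit Types A B : cstarAlgType R.

Definition cnorm_cvg A (u : nat -> A) (x : A) : Prop :=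
  cnorm (u n - x) @[n --> \oo] --> (0 : R).

Definition cstar_subalgebra A (P : set A) : Prop :=
  P 1 /\ (forall x y, P x -> P y -> P (x + y)) /\
  (forall (c : R[i]) x, P x -> P (c *: x)) /\
  (forall x y, P x -> P y -> P (x * y)) /\
  (forall x, P x -> P (star x)) /\
  (forall u x, (forall n, P (u n)) -> cnorm_cvg u x -> P x).

Definition cstar_generated A (S : set A) : Prop :=
  forall P : set A, cstar_subalgebra P -> S `<=` P -> P = setT.

Definition star_morphism A B (f : A -> B) : Prop :=
  forall x, f (star x) = star (f x).

Definition projection A (p : A) : Prop := star p = p /\ p * p = p.

Definition partial_isometry A (s : A) : Prop := s * star s * s = s.

(* Riemann integral over [a, b] of a function with values in a C*-algebra. *)
Definition is_riemann_integral A (f : R -> A) (a b : R) (I : A) : Prop :=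
  forall e : R, 0 < e -> exists2 d : R, 0 < d &
  forall (n : nat) (t xi : nat -> R), t 0%N = a -> t n = b ->
    (forall i, (i < n)%N -> t i <= xi i <= t i.+1 /\ t i.+1 - t i < d) ->
    cnorm (\sum_(i < n) (t i.+1 - t i)%:C *: f (xi i) - I) < e.

Definition cis (t : R) : R[i] := (cos t +i* sin t)%C.

End CStarAlgebras.

Definition lin_span (K : nzRingType) (V : lmodType K) (S : set V) : set V :=
  [set v | exists (n : nat) (c : 'I_n -> K) (x : 'I_n -> V),
     (forall i, S (x i)) /\ v = \sum_i c i *: x i].

Section QuantumSU2.
Context {R : realType}.
Implicit Types (A B : cstarAlgType R) (q : R).

Definition suq2_relations q A (a b : A) : Prop :=
  [/\ star b * b = b * star b,
      star a * a + star b * b = 1,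
      a * star a + (q ^+ 2)%:C *: (b * star b) = 1,
      a * b = q%:C *: (b * a)
    & a * star b = q%:C *: (star b * a)].

Definition is_CSUq2 q A (a b : A) : Prop :=
  [/\ suq2_relations q a b,
      cstar_generated [set x | x = a \/ x = b]
    & forall B (a' b' : B), suq2_relations q a' b' ->
        exists f : {lrmorphism A -> B}, [/\ star_morphism f, f a = a' & f b = b']].

Record graph_family A := GraphFamily {
  pv : A; pw : A; Smu : A; Snu : A; Sxi : A }.

Definition graph_relations A (s : graph_family A) : Prop :=
  [/\ projection (pv s) /\ projection (pw s),
      pv s * pw s = 0 /\ pv s + pw s = 1,
      [/\ partial_isometry (Smu s), partial_isometry (Snu s)
        & partial_isometry (Sxi s)],
      star (Smu s) * Smu s = pv s /\
        Smu s * star (Smu s) + Snu s * star (Snu s) = pv s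
    & [/\ star (Snu s) * Snu s = pw s, star (Sxi s) * Sxi s = pw s
        & Sxi s * star (Sxi s) = pw s]].

Definition is_graph_algebra A (s : graph_family A) : Prop :=
  [/\ graph_relations s,
      cstar_generated [set x | x = pv s \/ x = pw s \/ x = Smu s \/
                               x = Snu s \/ x = Sxi s]
    & forall B (s' : graph_family B), graph_relations s' ->
        exists f : {lrmorphism A -> B}, star_morphism f /\
          [/\ f (pv s) = pv s', f (pw s) = pw s', f (Smu s) = Smu s',
              f (Snu s) = Snu s' & f (Sxi s) = Sxi s']].

Definition suq2_graph_identification q A (s : graph_family A) (a b : A) : Prop :=
  let S := Smu s + Snu s in
  let S' := star (Smu s) + star (Snu s) in
  cnorm_cvg (fun n => \sum_(0 <= k < n)
      (Num.sqrt (1 - q ^+ (2 * k.+1)) - Num.sqrt (1 - q ^+ (2 * k)))%:C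
        *: (S ^+ k * S' ^+ k.+1)) a /\
  cnorm_cvg (fun n => \sum_(0 <= k < n)
      (q ^+ k)%:C *: (S ^+ k * Sxi s * S' ^+ k)) b.

Definition Tvec A (s : graph_family A) (k : nat) : A :=
  if k is 0%N then pv s else Smu s ^+ k.

Definition Ttilde A (s : graph_family A) (k : nat) : A :=
  if k is k'.+1 then Smu s ^+ k' * Snu s else pw s.

Definition Uvec A (s : graph_family A) (n : int) : A :=
  match n with
  | Posz 0 => pw s
  | Posz m => Sxi s ^+ m
  | Negz m => star (Sxi s) ^+ m.+1
  end.

Definition Ac A (s : graph_family A) : set A :=
  lin_span [set x | (exists k l, x = Tvec s k * star (Tvec s l)) \/
    (exists k n l, x = Ttilde s k * Uvec s n * star (Ttilde s l))].

Inductive suq2_letter := La | Lastar | Lb | Lbstar.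

Definition letter_val A (a b : A) (l : suq2_letter) : A :=
  match l with La => a | Lastar => star a | Lb => b | Lbstar => star b end.

Definition letter_deg (l : suq2_letter) : int * int :=
  match l with
  | La => (-1, 0) | Lastar => (1, 0) | Lb => (0, 1) | Lbstar => (0, -1)
  end.

(* By linearity it is enough to ask for vanishing on monomials. *)
Definition is_haar_state q A (a b : A) (h : {scalar A}) : Prop :=
  [/\ forall x, 0 <= h (star x * x),
      h 1 = 1,
      forall w : seq suq2_letter, \sum_(l <- w) letter_deg l <> 0 ->
        h (\prod_(l <- w) letter_val a b l) = 0
    & forall n, h (star b ^+ n * b ^+ n)
                = ((1 - q ^+ 2) / (1 - q ^+ (2 * n + 2)))%:C].

Definition is_circle_action A (s : graph_family A)
    (sigma : R[i] -> {lrmorphism A -> A}) : Prop :=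
  [/\ forall z, `|z| = 1 -> star_morphism (sigma z),
      forall x, sigma 1 x = x,
      forall z w x, `|z| = 1 -> `|w| = 1 ->
        sigma (z * w) x = sigma z (sigma w x),
      forall x z, `|z| = 1 -> forall e : R, 0 < e -> exists2 d : R, 0 < d &
        forall w, `|w| = 1 -> complex.Re `|w - z| < d ->
        cnorm (sigma w x - sigma z x) < e
    & forall z, `|z| = 1 ->
        [/\ sigma z (Smu s) = z *: Smu s, sigma z (Snu s) = z *: Snu s
          & sigma z (Sxi s) = Sxi s]].

Definition is_fourier_component A (sigma : R[i] -> {lrmorphism A -> A})
    (Phi : int -> A -> A) : Prop :=
  forall m x, exists2 I : A,
    is_riemann_integral
      (fun t : R => cis (- (m%:~R * t)) *: sigma (cis t) x) 0 (2 * pi) I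
  & Phi m x = ((2 * pi)^-1)%:C *: I.

Definition qint q (k : nat) : R := (1 - q ^+ (2 * k)) / (1 - q ^+ 2).

End QuantumSU2.

(* The library forms are linear on the left and antilinear on the right, hence
   the inner product <x, y>, linear in y, is dot y x. Unbounded operators are
   represented by their graphs. *)
Section HilbertSpace.
Context {R : realType} (H : completeNormedModType R[i]).
Variable dot : {dot H for Num.conj}.
Implicit Types (S T E P Q p : H -> H) (G D : set (H * H)).

Definition ip (x y : H) : R[i] := dot y x.

Definition hilbert_norm : Prop := forall x : H, `|x| ^+ 2 = ip x x.

Definition bounded_op T : Prop := linear T /\ continuous T.

Definition adjoint_op T T' : Prop := forall x y, ip (T x) y = ip x (T' y).

Definition orth_projection E : Prop :=
  [/\ bounded_op E, forall x, E (E x) = E x & adjoint_op E E].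

Definition projection_onto E (K : set H) : Prop :=
  orth_projection E /\ range E = K.

Definition commutant (M : set (H -> H)) : set (H -> H) :=
  [set T | bounded_op T /\ forall S, M S -> forall x, T (S x) = S (T x)].

Definition bicommutant (M : set (H -> H)) := commutant (commutant M).

Definition corner (N : set (H -> H)) p : set (H -> H) :=
  [set T | N T /\ forall x, p (T (p x)) = T x].

Definition linear_graph G : Prop :=
  G (0, 0) /\ forall (c : R[i]) x y x' y', G (x, y) -> G (x', y') ->
    G (c *: x + x', c *: y + y').

(* G is the self-adjoint operator on the Hilbert space p H whose
   projection-valued measure is E, that is G = \int t dE(t):
   mu x is the scalar measure <x, E(.) x>. *)
Definition spectral_resolution p G (E : set R -> H -> H) : Prop :=
  [/\ linear_graph G,
      forall B : set (measurableTypeR R), measurable B -> orth_projection (E B),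
      E setT = p,
      forall B C : set (measurableTypeR R), measurable B -> measurable C ->
        forall x, E (B `&` C) x = E B (E C x)
    & exists mu : H -> {measure set (measurableTypeR R) -> \bar R},
      [/\ forall x B, measurable B ->
            mu x B = (complex.Re (ip x (E B x)))%:E,
          forall x, (exists y, G (x, y)) <->
            p x = x /\ (\int[mu x]_t (t ^+ 2)%:E < +oo)%E
        & forall x y, G (x, y) ->
            p y = y /\ ip x y = (fine (\int[mu x]_t t%:E)%E)%:C]].

Definition nonneg_spectral_projection p G P : Prop :=
  exists2 E, spectral_resolution p G E & P = E [set t | 0 <= t].

(* From here on, N is a von Neumann algebra of operators on p H and tau is the
   trace on its positive part. *)

(* T in P N Q is (P, Q)-Breuer-Fredholm, as an operator from ran Q to ran P,
   with index r. *)
Definition BF_index (N : set (H -> H)) (tau : (H -> H) -> \bar R)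
    P Q T (r : R) : Prop :=
  [/\ [/\ orth_projection P, N P, orth_projection Q & N Q],
      N T /\ (forall x, P (T (Q x)) = T x),
      exists P1, [/\ orth_projection P1, N P1, forall x, P (P1 x) = P1 x,
        (tau (fun x => (P x - P1 x)%R) < +oo)%E & range P1 `<=` range T]
    & exists T' Ker Coker,
      [/\ adjoint_op T T',
          N Ker /\ projection_onto Ker [set x | Q x = x /\ T x = 0],
          N Coker /\ projection_onto Coker [set x | P x = x /\ T' x = 0],
          (tau Ker < +oo)%E /\ (tau Coker < +oo)%E
        & r = fine (tau Ker) - fine (tau Coker)]].

(* The norm-closed ideal of N generated by the projections of finite trace. *)
Definition tau_compact (N : set (H -> H)) (tau : (H -> H) -> \bar R)
    (K : H -> H) : Prop :=
  N K /\ forall e : R, 0 < e ->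
    exists (n : nat) (c : 'I_n -> R[i]) (F : 'I_n -> H -> H),
    (forall i, [/\ orth_projection (F i), N (F i) & (tau (F i) < +oo)%E]) /\
    forall x, `|K x - \sum_i c i *: F i x| <= e%:C * `|x|.

(* The norm of S - T in the quotient of N by this ideal is less than 1. *)
Definition calkin_close (N : set (H -> H)) (tau : (H -> H) -> \bar R) S T
  : Prop :=
  exists K, tau_compact N tau K /\ exists2 c : R, c < 1 &
    forall x, `|S x - T x - K x| <= c%:C * `|x|.

Definition straight_path D0 D1 (t : R) : set (H * H) :=
  [set z | exists y0 y1, [/\ D0 (z.1, y0), D1 (z.1, y1)
     & z.2 = (1 - t)%:C *: y0 + t%:C *: y1]].

(* Phillips' analytic spectral flow, along the straight line path from D0 to
   D1: the path is cut into pieces on which the non-negative spectral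
   projections P t vary by less than 1 in the quotient by the ideal of compacts,
   and the indices of P (s i) P (s (i+1)) are added up. *)
Definition spectral_flow (N : set (H -> H)) (tau : (H -> H) -> \bar R)
    p D0 D1 (r : R) : Prop :=
  exists P : R -> H -> H,
  (forall t, 0 <= t <= 1 ->
     nonneg_spectral_projection p (straight_path D0 D1 t) (P t) /\ N (P t)) /\
  exists (n : nat) (s ind : nat -> R),
  [/\ s 0%N = 0 /\ s n = 1,
      forall i, (i < n)%N -> s i < s i.+1,
      forall i, (i < n)%N -> forall u v, s i <= u <= s i.+1 ->
        s i <= v <= s i.+1 -> calkin_close N tau (P u) (P v),
      forall i, (i < n)%N ->
        BF_index N tau (P (s i)) (P (s i.+1))
          (fun x => P (s i) (P (s i.+1) x)) (ind i)
    & r = \sum_(i < n) ind i].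

End HilbertSpace.

Section GNSSpace.
Context {R : realType} (A : cstarAlgType R) (H : completeNormedModType R[i]).
Variables (dot : {dot H for Num.conj}) (s : graph_family A).
Variables (Lam : {linear A -> H}) (rep : A -> H -> H).

(* (H, rep, Lam) is the GNS construction of h; Lam x is the vector given by x. *)
Definition is_gns (h : {scalar A}) : Prop :=
  [/\ hilbert_norm dot,
      forall x y, ip dot (Lam x) (Lam y) = h (star x * y),
      dense (range Lam),
      forall x, bounded_op (rep x)
    & forall x y, rep x (Lam y) = Lam (x * y)].

Definition is_extension (f : A -> A) (T : H -> H) : Prop :=
  bounded_op T /\ forall x, T (Lam x) = Lam (f x).

Definition form_F (Phi : int -> A -> A) (x y : A) : A := Phi 0 (star x * y).

Definition Theta (Phi : int -> A -> A) (x y z : A) : A := x * form_F Phi y z.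

Definition EndF00 (Phi : int -> A -> A) : set (H -> H) :=
  lin_span [set T | exists x y,
    [/\ Ac s x, Ac s y & is_extension (Theta Phi x y) T]].

(* \sum_m m PhiH m, with domain the vectors on which the symmetric partial sums
   converge; as the PhiH m are mutually orthogonal projections this is the
   maximal domain, where \sum_m m^2 |PhiH m x|^2 is finite. *)
Definition dirac_graph (PhiH : int -> H -> H) : set (H * H) :=
  [set z | (\sum_(i < n.*2.+1) ((i : nat)%:Z - n%:Z)%:~R
              *: PhiH ((i : nat)%:Z - n%:Z) z.1) @[n --> \oo] --> z.2].

Definition htilde (V : H -> H) : \bar R :=
  let m (x : A) := (complex.Re (ip dot (Lam x) (V (Lam x))))%:E in
  (m 1%R + \sum_(1 <= j <oo)
     (m (Tvec s j) + m (Ttilde s j) + m (star (Tvec s j))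
      + m (star (Ttilde s j))))%E.

(* x x* D and x D x* as operators on x x* H. *)
Definition range_mul (x : A) (D : set (H * H)) : set (H * H) :=
  [set z | rep (x * star x) z.1 = z.1 /\
     exists2 y, D (z.1, y) & z.2 = rep (x * star x) y].

Definition range_conj (x : A) (D : set (H * H)) : set (H * H) :=
  [set z | rep (x * star x) z.1 = z.1 /\
     exists2 y, D (rep (star x) z.1, y) & z.2 = rep x y].

End GNSSpace.

(* Main.v *)
Require Import Defs.
From HB Require Import structures.
From mathcomp Require Import all_boot all_order all_algebra.
From mathcomp Require Import complex.
From mathcomp Require Import all_classical all_reals all_analysis.
From mathcomp Require Import measurable_realfun.
From mathcomp Require Import zify ring lra.

Set Implicit Arguments.
Unset Strict Implicit.
Unset Printing Implicit Defensive.

Import Order.TTheory GRing.Theory Num.Theory.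
Import numFieldNormedType.Exports.

Local Open Scope classical_set_scope.
Local Open Scope ring_scope.
Local Open Scope complex_scope.

(* Write S = S_mu + S_nu, an isometry with S S^* = p_v; then T_k = S^k p_v and
   T~_k = S^k p_w, and A is generated by S and S_xi. The element b is the fixed
   point of y |-> S_xi + q S y S^*, so that y_n = b^{*n} b^n satisfies
   y_n = p_w + q^{2n} S y_n S^*; as n varies, the moments of the Haar state
   force h(S^k p_w S^{*k}) = (1 - q^2) q^{2k}, hence h(S^k S^{*k}) = q^{2k}.

   For x = S^k r with r = p_v or p_w, the path from x x^* D to x D x^* is
   x x^* (D - t k), whose non-negative spectral projection is
   P_t = x x^* \sum_{m >= t k} Phi_m. These projections commute and differ by
   finite-trace projections, so a single piece of the path is enough, and the
   index of P_0 P_1 is minus the trace of x x^* \sum_{0 <= m < k} Phi_m, that is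
   - \sum_{i = 1}^k h(S^i r S^{*i}). *)

(** Two facts used tacitly above carry most of the work. The operators Phi_m are orthogonal
    projections of the GNS space only if [h] is invariant under [sigma]. But [h] is prescribed on
    words in [a], [b], whereas degrees are defined on the graph generators. The link is that [a] and
    [b] are norm limits of elements homogeneous of degree -1 and 0, together with the boundedness of
    states, which rests on square roots of 1 - c. Secondly, the P_t must lie in the von Neumann
    algebra generated by the Theta_{y,z}. This is where the sign of m matters: a vector of degree m
    >= 0 lies in the range of S^m S^{*m}, which makes x x^* Phi_m a single Theta_{y,z} or zero.
    Since 0 <= t k, no negative m ever occurs in P_t. *)

Section LinearSpan.
Context {K : nzRingType} {V : lmodType K}.
Implicit Types (M : set V) (u v : V).

Lemma lin_span_gen M u : M u -> lin_span M u.
Proof.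
move=> Mu; exists 1%N, (fun=> 1), (fun=> u); split=> //.
by rewrite big_ord1 scale1r.
Qed.

Lemma lin_spanD M u v : lin_span M u -> lin_span M v -> lin_span M (u + v).
Proof.
move=> [m [c [x [Mx ->]]]] [n [d [y [My ->]]]].
exists (m + n)%N, (fun i => match fintype.split i with inl j => c j | inr j => d j end),
  (fun i => match fintype.split i with inl j => x j | inr j => y j end).
split=> [i|]; first by case: (fintype.split i).
rewrite big_split_ord; congr (_ + _); apply: eq_bigr => i _.
  by rewrite (unsplitK (inl i)).
by rewrite (unsplitK (inr i)).
Qed.

End LinearSpan.

Section EnumerationOfIntegers.

(** The Fourier projections are indexed by the integers, while orthogonal families, series and
    discrete measures are treated below over the naturals; this bijection relabels them. *)
Definition enumZ (n : nat) : int := if odd n then Negz n./2 else Posz n./2.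

Definition rankZ (m : int) : nat := match m with Posz k => k.*2 | Negz k => k.*2.+1 end.

Lemma rankZK : cancel rankZ enumZ.
Proof.
by case=> k; rewrite /enumZ /= ?odd_double ?doubleK// uphalf_double.
Qed.

Lemma enumZK : cancel enumZ rankZ.
Proof.
move=> n; rewrite /enumZ; have := odd_double_half n.
by case: (odd n) => /= e; rewrite -[RHS]e.
Qed.

End EnumerationOfIntegers.

Lemma eseries_eventually0 {R : realType} (u : nat -> R) m K : (m <= K)%N ->
  (forall j, (K <= j)%N -> u j = 0) ->
  (\sum_(m <= j <oo) (u j)%:E = (\sum_(m <= j < K) u j)%:E)%E.
Proof.
move=> mK u0; apply/cvg_lim => //; apply: cvg_near_cst; exists K => // n /= Kn.
rewrite sumEFin (@big_cat_nat _ _ _ K)//=.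
by rewrite [X in _ + X]big_nat_cond [X in _ + X]big1 ?addr0// => j /andP[/andP[/u0]].
Qed.

(** * C*-algebras *)

Section CStarTheory.
Context {R : realType} {A : cstarAlgType R}.
Implicit Types (x y z c : A) (e M : R).

Lemma star0 : star (0 : A) = 0.
Proof. by rewrite -(scale0r (0 : A)) starZ rmorph0 !scale0r. Qed.

Lemma star1 : star (1 : A) = 1.
Proof. by rewrite -[LHS]mulr1 -{2}(starK 1) -starM mulr1 starK. Qed.

Lemma starN x : star (- x) = - star x.
Proof. by rewrite -scaleN1r starZ rmorphN rmorph1 scaleN1r. Qed.

Lemma starB x y : star (x - y) = star x - star y.
Proof. by rewrite starD starN. Qed.

Lemma starX x n : star (x ^+ n) = star x ^+ n.
Proof. by elim: n => [|n IHn]; rewrite ?expr0 ?star1// exprS starM IHn -exprSr. Qed.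

Lemma cnormZr (r : R) x : cnorm (r%:C *: x) = `|r| * cnorm x.
Proof. by rewrite cnormZ normc_def /= expr0n addr0 sqrtr_sqr. Qed.

Lemma cnorm0 : cnorm (0 : A) = 0.
Proof. by rewrite -(scale0r (0 : A)) cnormZr normr0 mul0r. Qed.

Lemma cnormN x : cnorm (- x) = cnorm x.
Proof. by rewrite -scaleN1r cnormZ normrN1 mul1r. Qed.

Lemma cnormBC x y : cnorm (x - y) = cnorm (y - x).
Proof. by rewrite -cnormN opprB. Qed.

Lemma cnorm_ge0 x : 0 <= cnorm x.
Proof.
have := ler_cnormD x (- x); rewrite subrr cnorm0 cnormN; lra.
Qed.

Lemma ler_cnormB x y : cnorm (x - y) <= cnorm x + cnorm y.
Proof. by rewrite -(cnormN y) ler_cnormD. Qed.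

Lemma ler_cnorm_dist y x z : cnorm (x - z) <= cnorm (x - y) + cnorm (y - z).
Proof. by rewrite -{1}(subrK y x) -addrA ler_cnormD. Qed.

(** The C*-identity gives |y|^2 = |y^* y| <= |y^*| |y|; divide by |y|, then apply the same to
    y^*. *)
Lemma cnorm_starE x : cnorm (star x) = cnorm x.
Proof.
suff le y : cnorm y <= cnorm (star y).
  by apply/eqP; rewrite eq_le le -{2}(starK x) le.
have [->|y0] := eqVneq (cnorm y) 0; first exact: cnorm_ge0.
have y_gt0 : 0 < cnorm y by rewrite lt_def y0 cnorm_ge0.
by rewrite -(ler_pM2r y_gt0) -expr2 -cnorm_star ler_cnormM.
Qed.

Lemma cnorm1 : cnorm (1 : A) = 1.
Proof.
have := cnorm_star (1 : A); rewrite star1 mulr1 => n1.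
have n0 : cnorm (1 : A) != 0.
  by apply/eqP => /cnorm0_eq0/eqP; rewrite oner_eq0.
by apply: (mulfI n0); rewrite mulr1 -expr2 -n1.
Qed.

Lemma cnorm_small x : (forall e, 0 < e -> cnorm x < e) -> x = 0.
Proof.
move=> x0; apply: cnorm0_eq0; apply/eqP; rewrite eq_le cnorm_ge0 andbT.
by apply/ler_addgt0Pr => e e0; rewrite add0r ltW// x0.
Qed.

Lemma cnorm_cvgP (u : nat -> A) x : cnorm_cvg u x <->
  forall e, 0 < e -> exists N, forall n, (N <= n)%N -> cnorm (u n - x) < e.
Proof.
split=> [/cvgrPdist_lt ux e e0|ux].
  have [N _ Nux] := ux e e0; exists N => n Nn.
  by have := Nux n Nn; rewrite sub0r normrN ger0_norm ?cnorm_ge0.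
apply/cvgrPdist_lt => e e0; have [N Nux] := ux e e0; exists N => // n Nn.
by rewrite sub0r normrN ger0_norm ?cnorm_ge0 ?Nux.
Qed.

Lemma cnorm_cauchy_cvg (u : nat -> A) :
  (forall e, 0 < e -> exists N, forall n m, (N <= n)%N -> cnorm (u (n + m)%N - u n) < e) ->
  exists x, cnorm_cvg u x.
Proof.
move=> cu; apply: cnorm_complete => e e0.
have [N Nu] := cu (e / 2) ltac:(lra); exists N => m n Nm Nn.
have := Nu N (m - N)%N (leqnn _); have := Nu N (n - N)%N (leqnn _).
rewrite !subnKC// => un um.
have := ler_cnorm_dist (u N) (u m) (u n); rewrite (cnormBC (u N)); lra.
Qed.

(* The square root of 1 - c is 1 - v, with v = (c + v^2)/2 the limit of the
   iteration f; the ball of radius r is stable under f because the norm of c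
   is 2 r - r^2, and f is r-Lipschitz on it. *)
Lemma one_sub_square c : star c = c -> cnorm c < 1 ->
  exists y, 1 - c = star y * y.
Proof.
move=> sc c1; set rho := cnorm c in c1.
pose s := Num.sqrt (1 - rho); pose r := 1 - s.
have s0 : 0 < s by rewrite sqrtr_gt0 subr_gt0.
have ss : s ^+ 2 = 1 - rho by rewrite sqr_sqrtr// subr_ge0 ltW.
have rho0 : 0 <= rho := cnorm_ge0 c.
have s1 : s <= 1 by rewrite expr2 in ss; nra.
have rr : rho + r * r = 2 * r by rewrite /r; move: ss; rewrite expr2; nra.
have r0 : 0 <= r by rewrite /r; lra.
have r1 : r < 1 by rewrite /r; lra.
pose f w := (2^-1)%:C *: (c + w * w).
pose w := fix w n := if n is m.+1 then f (w m) else 0.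
have fE u v : f u - f v = (2^-1)%:C *: (u * (u - v) + (u - v) * v).
  rewrite /f -scalerBr; congr (_ *: _).
  by rewrite mulrBr mulrBl opprD addrACA subrr add0r addrA subrK.
have half x : cnorm ((2^-1)%:C *: x) = cnorm x / 2.
  by rewrite cnormZr ger0_norm ?invr_ge0// mulrC.
have wr n : cnorm (w n) <= r.
  elim: n => [|n IHn] /=; first by rewrite cnorm0.
  rewrite half; have := ler_cnormD c (w n * w n).
  have := ler_cnormM (w n) (w n); have := cnorm_ge0 (w n).
  rewrite -/rho; nra.
have sw n : star (w n) = w n.
  elim: n => [|n IHn] /=; first exact: star0.
  by rewrite /f starZ starD starM IHn sc [Num.conj _]conjc_real.
have fL u v : cnorm u <= r -> cnorm v <= r -> cnorm (f u - f v) <= r * cnorm (u - v).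
  move=> ur vr; rewrite fE half.
  have := ler_cnormD (u * (u - v)) ((u - v) * v).
  have := ler_cnormM u (u - v); have := ler_cnormM (u - v) v.
  have := cnorm_ge0 (u - v); have := cnorm_ge0 u; have := cnorm_ge0 v; nra.
(* The iteration starts at 0, so every iterate is within r of the start; each application of [f]
   contracts the distance by r. *)
have wc n m : cnorm (w (n + m)%N - w n) <= r ^+ n.
  elim: n => [|n IHn]; first by rewrite add0n /= subr0 expr0 (le_trans (wr _)) ?ltW.
  rewrite addSn exprS (le_trans (fL _ _ (wr _) (wr _)))// ler_wpM2l//.
have rn e : 0 < e -> exists N, forall n, (N <= n)%N -> r ^+ n < e.
  move=> e0; have : r ^+ n @[n --> \oo] --> 0 by apply: cvg_expr; rewrite ger0_norm.
  move=> /cvgrPdist_lt/(_ e e0)[N _ Nr]; exists N => n Nn.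
  by have := Nr n Nn; rewrite /= sub0r normrN ger0_norm// exprn_ge0.
have [v /cnorm_cvgP wv] : exists v, cnorm_cvg w v.
  apply: cnorm_cauchy_cvg => e e0; have [N Nr] := rn e e0.
  by exists N => n m /Nr; apply: le_lt_trans.
have vr : cnorm v <= r.
  apply/ler_addgt0Pr => e e0; have [N Nw] := wv e e0.
  have := Nw N (leqnn _); have := ler_cnormB (w N) (w N - v).
  by rewrite subKr; have := wr N; lra.
have sv : star v = v.
  apply/eqP; rewrite -subr_eq0; apply/eqP/cnorm_small => e e0.
  have [N Nw] := wv (e / 2) ltac:(lra); have := Nw N (leqnn _) => wN.
  have := ler_cnorm_dist (w N) (star v) v.
  have -> : cnorm (star v - w N) = cnorm (w N - v).
    by rewrite -[w N in LHS]sw -starB cnorm_starE cnormBC.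
  lra.
have vE : v = f v.
  apply/eqP; rewrite -subr_eq0; apply/eqP/cnorm_small => e e0.
  have [N Nw] := wv (e / 2) ltac:(lra).
  have := Nw N (leqnn _); have := Nw N.+1 (leqnSn _) => /= wN1 wN.
  have := ler_cnorm_dist (f (w N)) v (f v); have := fL _ _ (wr N) vr.
  by rewrite (cnormBC v (f (w N))); have := cnorm_ge0 (w N - v); nra.
have -> : c = v + v - v * v.
  rewrite {1 2}vE /f -scalerDl -rmorphD /= -[2^-1]mul1r -splitr scale1r.
  by rewrite addrK.
exists (1 - v); rewrite starB star1 sv mulrBl mul1r mulrBr mulr1 !opprB opprD.
by rewrite -[RHS]addrA [- v + (_ - v)]addrCA.
Qed.

End CStarTheory.

(** * Norm bounds for states *)

Section State.
Context {R : realType} {A : cstarAlgType R} (f : {scalar A}).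
Hypothesis f_ge0 : forall x, 0 <= f (star x * x).
Hypothesis f1 : f 1 = 1.
Implicit Types (x c : A) (M : R).

(** Since |c / M| < 1, the element 1 - c / M has the form y^* y, and [f] is nonnegative on it. *)
Lemma state_selfadj_le c M : star c = c -> cnorm c < M -> f c <= M%:C.
Proof.
move=> sc cM; have M0 : 0 < M by apply: le_lt_trans cM; exact: cnorm_ge0.
have MC0 : 0 < M%:C :> R[i] by rewrite ltcR.
have [||y yE] := @one_sub_square _ _ ((M^-1)%:C *: c).
- by rewrite starZ sc [Num.conj _]conjc_real.
- by rewrite cnormZr gtr0_norm ?invr_gt0// mulrC ltr_pdivrMr// mul1r.
have := f_ge0 y; rewrite -yE linearB f1 linearZ /= subr_ge0.
by rewrite fmorphV mulrC ler_pdivrMr// mul1r.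
Qed.

(** In the order of [R[i]], f c <= M already makes f c real; the bounds for c and for -c then bound
    its modulus. *)
Lemma state_selfadj_norm c M : star c = c -> cnorm c < M -> `|f c| <= M%:C.
Proof.
move=> sc cM; have fcM := state_selfadj_le sc cM.
rewrite real_ler_norml ?fcM ?andbT; last first.
  by rewrite (ler_real fcM) ger0_real// ltW// ltcR; apply: le_lt_trans cM; exact: cnorm_ge0.
rewrite lerNl -linearN; apply: state_selfadj_le.
    by rewrite starN sc.
  by rewrite cnormN.
Qed.

(** Here c and d are the real and imaginary parts of x. The factor 2 is the cost of treating them
    separately and is harmless, as only continuity of [f] is wanted. *)
Lemma state_norm x M : cnorm x < M -> `|f x| <= (M *+ 2)%:C.
Proof.
move=> xM; pose c := (2^-1)%:C *: (x + star x).
pose d := (2^-1)%:C *: ('i *: (star x - x)).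
have xE : x = c + 'i *: d.
  have -> : 'i *: d = (2^-1)%:C *: (x - star x).
    by rewrite /d scalerA (mulrC 'i) -scalerA [X in _ *: X]scalerA -expr2 sqr_i scaleN1r opprB.
  rewrite -scalerDr addrCA addrK -mulr2n -(scaler_nat 2 x) scalerA.
  by rewrite -(rmorph_nat (real_complex R)) -rmorphM mulVf ?rmorph1 ?scale1r ?pnatr_eq0.
have half y : cnorm ((2^-1)%:C *: y) = cnorm y / 2.
  by rewrite cnormZr ger0_norm ?invr_ge0// mulrC.
have c1 : `|f c| <= M%:C.
  apply: state_selfadj_norm.
    by rewrite starZ starD starK [Num.conj _]conjc_real addrC.
  by rewrite half; have := ler_cnormD x (star x); rewrite cnorm_starE; lra.
have d1 : `|f d| <= M%:C.
  apply: state_selfadj_norm.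
    rewrite !starZ starB starK [Num.conj (_%:C)]conjc_real.
    have -> : Num.conj 'i = - 'i :> R[i] by simpc.
    by rewrite scaleNr -scalerN opprB.
  rewrite half cnormZ normc_def /= expr0n expr1n add0r sqrtr1 mul1r.
  by have := ler_cnormB (star x) x; rewrite cnorm_starE; lra.
clearbody c d; rewrite xE linearD linearZ /= (le_trans (ler_normD _ _))// normrM.
have -> : `|'i : R[i]| = 1 by rewrite normc_def /= expr0n expr1n add0r sqrtr1.
by rewrite mul1r mulr2n rmorphD lerD.
Qed.

(** No factor is lost here, x^* x being self-adjoint of norm |x|^2; this makes the GNS map a
    contraction. *)
Lemma state_sqr_le x M : cnorm x < M -> f (star x * x) <= (M ^+ 2)%:C.
Proof.
move=> xM; apply: state_selfadj_le; first by rewrite starM starK.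
by rewrite cnorm_star ltr_pXn2r// ?nnegrE ?cnorm_ge0// (le_trans _ (ltW xM)) ?cnorm_ge0.
Qed.

End State.

(** * Norm closures of spans *)

Section Approximation.
Context {R : realType} {A : cstarAlgType R}.
Implicit Types (M : set A) (x y : A).

Definition approx M x := forall e : R, 0 < e -> exists2 y, M y & cnorm (x - y) < e.

Lemma approx_sub M x : M x -> approx M x.
Proof. by move=> Mx e e0; exists x; rewrite // subrr cnorm0. Qed.

Lemma approx_trans M x : approx (approx M) x -> approx M x.
Proof.
move=> Mx e e0; have [y My xy] := Mx (e / 2) ltac:(lra).
have [z Mz yz] := My (e / 2) ltac:(lra); exists z => //.
by have := ler_cnorm_dist y x z; lra.
Qed.

Lemma approxS M M' x : M `<=` M' -> approx M x -> approx M' x.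
Proof. by move=> MM' Mx e /Mx[y /MM' My xy]; exists y. Qed.

Lemma approxD M1 M2 M x y : (forall u v, M1 u -> M2 v -> M (u + v)) ->
  approx M1 x -> approx M2 y -> approx M (x + y).
Proof.
move=> MD Mx My e e0; have [u Mu xu] := Mx (e / 2) ltac:(lra).
have [v Mv yv] := My (e / 2) ltac:(lra); exists (u + v); first exact: MD.
rewrite opprD addrACA; have := ler_cnormD (x - u) (y - v); lra.
Qed.

Lemma approxM M1 M2 M x y : (forall u v, M1 u -> M2 v -> M (u * v)) ->
  approx M1 x -> approx M2 y -> approx M (x * y).
Proof.
move=> MM Mx My e e0; have nx := cnorm_ge0 x; have ny := cnorm_ge0 y.
have kx : 0 < cnorm x + 1 by lra.
have ky : 0 < cnorm y + 1 by lra.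
(* The approximant v is also kept within 1 of y, so that |v| <= |y| + 1 in x y - u v = x (y - v) +
   (x - u) v. *)
have [v Mv yv] := My (Num.min 1 (e / 2 / (cnorm x + 1))) ltac:(rewrite lt_min ltr01 !divr_gt0//).
have [u Mu xu] := Mx (e / 2 / (cnorm y + 1)) ltac:(rewrite !divr_gt0//).
exists (u * v); first exact: MM.
move: yv; rewrite lt_min => /andP[yv1]; rewrite ltr_pdivlMr// => yv.
move: xu; rewrite ltr_pdivlMr// => xu.
have nv : cnorm v <= cnorm y + 1.
  by have := ler_cnormB y (y - v); rewrite subKr; lra.
have -> : x * y - u * v = x * (y - v) + (x - u) * v.
  by rewrite mulrBr mulrBl addrA subrK.
have := ler_cnormD (x * (y - v)) ((x - u) * v).
have := ler_cnormM x (y - v); have := ler_cnormM (x - u) v.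
have := cnorm_ge0 (y - v); have := cnorm_ge0 (x - u); have := cnorm_ge0 v; nra.
Qed.

Lemma approx_star M1 M x : (forall u, M1 u -> M (star u)) ->
  approx M1 x -> approx M (star x).
Proof.
move=> MS Mx e e0; have [u Mu xu] := Mx e e0; exists (star u); first exact: MS.
by rewrite -starB cnorm_starE.
Qed.

Lemma approx_cvg M u x : (forall n, M (u n)) -> cnorm_cvg u x -> approx M x.
Proof.
move=> Mu /cnorm_cvgP ux e e0; have [N Nu] := ux e e0.
by exists (u N) => //; rewrite cnormBC Nu.
Qed.

(** The linear span once more, now as an inductive predicate: properties of all combinations follow
    by induction on the number of terms. *)
Inductive lspan M : set A :=
| lspan0 : lspan M 0
| lspanS c x y : M x -> lspan M y -> lspan M (c *: x + y).

Lemma lspan_gen M x : M x -> lspan M x.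
Proof. by move=> Mx; rewrite -[x]addr0 -[x]scale1r; apply: lspanS => //; apply: lspan0. Qed.

Lemma lspanD M x y : lspan M x -> lspan M y -> lspan M (x + y).
Proof.
move=> Mx My; elim: Mx => [|c u v Mu _ IH]; first by rewrite add0r.
by rewrite -addrA; apply: lspanS.
Qed.

Lemma lspanZ M (c : R[i]) x : lspan M x -> lspan M (c *: x).
Proof.
elim=> [|d u v Mu _ IH]; first by rewrite scaler0; apply: lspan0.
by rewrite scalerDr scalerA; apply: lspanS.
Qed.

Lemma lspanM M x y : (forall u v, M u -> M v -> M (u * v)) ->
  lspan M x -> lspan M y -> lspan M (x * y).
Proof.
move=> MM; elim=> [|c u v Mu _ IH] My; first by rewrite mul0r; apply: lspan0.
rewrite mulrDl; apply: lspanD (IH My); rewrite -scalerAl; apply: lspanZ => {v IH}.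
elim: My => [|d v w Mv _ IH]; first by rewrite mulr0; apply: lspan0.
by rewrite mulrDr -scalerAr; apply: lspanS => //; apply: MM.
Qed.

Lemma lspan_star M x : (forall u, M u -> M (star u)) -> lspan M x -> lspan M (star x).
Proof.
move=> MS; elim=> [|c u v Mu _ IH]; first by rewrite star0; apply: lspan0.
by rewrite starD starZ; apply: lspanS => //; apply: MS.
Qed.

(** If [M] contains 1 and is stable under products and adjoints, the closure of its span is a
    C*-subalgebra, hence everything as soon as it contains generators. *)
Lemma approx_lspan_generated (S M : set A) : cstar_generated S ->
  M 1 -> (forall u v, M u -> M v -> M (u * v)) -> (forall u, M u -> M (star u)) ->
  S `<=` approx (lspan M) -> forall x, approx (lspan M) x.
Proof.
move=> gS M1 MM MS SM x; suff -> : approx (lspan M) = setT by [].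
apply: gS SM; split; first exact/approx_sub/lspan_gen.
split; first by move=> u v; apply: approxD; apply: lspanD.
split; first move=> c u Mu.
  (* Scaling by c is multiplication by [c%:A], so it is covered by the product rule. *)
  have := @approxM [set c%:A] _ (lspan M) c%:A u _ (approx_sub (erefl _)) Mu.
  rewrite -scalerAl mul1r; apply=> _ v -> Mv; rewrite -scalerAl mul1r.
  exact: lspanZ.
split; first by move=> u v; apply: approxM => *; apply: lspanM.
split; first by move=> u; apply: approx_star => *; apply: lspan_star.
by move=> u v Mu uv; apply: approx_trans; apply: approx_cvg uv.
Qed.

End Approximation.

Section Cis.
Context {R : realType}.
Implicit Types t u : R.

Lemma cis0 : cis (0 : R) = 1.
Proof. by rewrite /cis cos0 sin0. Qed.

Lemma cisD t u : cis (t + u) = cis t * cis u.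
Proof. by rewrite /cis cosD sinD; simpc; congr (_ +i* _); rewrite addrC. Qed.

Lemma conj_cis t : Num.conj (cis t) = cis (- t).
Proof. by rewrite /cis cosN sinN. Qed.

Lemma norm_cis t : `|cis t| = 1.
Proof. by rewrite normc_def /= cos2Dsin2 sqrtr1. Qed.

Lemma cisX t n : cis t ^+ n = cis (n%:R * t).
Proof.
elim: n => [|n IHn]; first by rewrite mul0r cis0.
by rewrite exprSr IHn -cisD -natr1 mulrDl mul1r.
Qed.

Lemma cis_2pi (d : int) : cis (d%:~R * (2 * pi)) = 1 :> R[i].
Proof.
have cisn (n : nat) : cis (n%:R * (2 * pi)) = 1 :> R[i].
  by rewrite -cisX /cis mulrC mulr_natr cos2pi sin2pi expr1n.
case: d => n; first exact: cisn.
rewrite NegzE rmorphN /= mulNr -conj_cis.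
by have := cisn n.+1; rewrite -pmulrn => ->; rewrite rmorph1.
Qed.

(** Because cos t = 1 - 2 sin^2 (t/2), and sin (t/2) > 0 for 0 < t/2 < pi. *)
Lemma cis_neq1 t : 0 < t < 2 * pi -> cis t != 1.
Proof.
move=> /andP[t0 tpi]; apply/eqP => -[ct st].
have : sin (t / 2) > 0 by apply: sin_gt0_pi; lra.
have := cosD (t / 2) (t / 2); rewrite -splitr ct.
have := cos2Dsin2 (t / 2); rewrite !expr2; nra.
Qed.

End Cis.

(** * The graph algebra *)

Section CuntzKrieger.
Context {R : realType} {A : cstarAlgType R} (s : graph_family A).
Hypothesis gs : graph_relations s.

Definition Sgen : A := Smu s + Snu s.
Local Notation S := Sgen.
Local Notation p := (pv s).
Local Notation w := (pw s).
Local Notation X := (Sxi s).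

Lemma pv_addpw : p + w = 1.
Proof. by case: gs => _ []. Qed.
Lemma pw_star : star w = w.
Proof. by case: gs => -[[_ _] []]. Qed.
Lemma pv_star : star p = p.
Proof. by case: gs => -[[]]. Qed.
Lemma pw_idem : w * w = w.
Proof. by case: gs => -[[_ _] []]. Qed.
Lemma pv_idem : p * p = p.
Proof. by case: gs => -[[]]. Qed.
Lemma pvpw : p * w = 0.
Proof. by case: gs => _ []. Qed.
Lemma pwpv : w * p = 0.
Proof. by rewrite -pw_star -pv_star -starM pvpw star0. Qed.

Lemma SmuE : Smu s * p = Smu s.
Proof. by case: gs => _ _ [h _ _] [<- _] _; rewrite mulrA. Qed.
Lemma SnuE : Snu s * w = Snu s.
Proof. by case: gs => _ _ [_ h _] _ [<- _ _]; rewrite mulrA. Qed.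
Lemma SxiE : X * w = X.
Proof. by case: gs => _ _ [_ _ h] _ [_ <- _]; rewrite mulrA. Qed.
Lemma pwSxi : w * X = X.
Proof. by case: gs => _ _ [_ _ h] _ [_ _ <-]. Qed.
Lemma Sxi_unitary : star X * X = w /\ X * star X = w.
Proof. by case: gs => _ _ _ _ []. Qed.

(** Expanding the square gives P Q + Q P = 0. Multiplying by P on the left and on the right gives P
    Q = - P Q P = Q P, hence 2 P Q = 0. *)
Lemma idempotent_sum_ortho (P Q : A) :
  P * P = P -> Q * Q = Q -> (P + Q) * (P + Q) = P + Q -> P * Q = 0.
Proof.
move=> PP QQ; rewrite mulrDl !mulrDr PP QQ [_ * P + Q]addrC addrACA.
move/(canRL (addKr _)); rewrite addNr => PQ0.
have PQP : P * Q = - (P * Q * P).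
  have /= := congr1 (fun y => P * y) PQ0; rewrite mulr0 mulrDr !mulrA PP => /eqP.
  by rewrite addr_eq0 => /eqP.
have QPP : Q * P = - (P * Q * P).
  have /= := congr1 (fun y => y * P) PQ0; rewrite mul0r mulrDl -(mulrA Q) PP => /eqP.
  by rewrite addrC addr_eq0 => /eqP.
move: PQ0; rewrite QPP -PQP -mulr2n -(scaler_nat 2) => /eqP.
by rewrite scaler_eq0 pnatr_eq0 => /eqP.
Qed.

(** Orthogonality of the two ranges is not among the graph relations; it is forced because the range
    projections add up to the projection [pv]. *)
Lemma Smu_Snu_ortho : star (Smu s) * Snu s = 0.
Proof.
case: gs => _ _ [hmu hnu _] [_ PQp] _.
have PQ : (Smu s * star (Smu s)) * (Snu s * star (Snu s)) = 0.
  by apply: idempotent_sum_ortho; rewrite ?PQp ?pv_idem// mulrA ?hmu ?hnu.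
have -> : star (Smu s) * Snu s =
    star (Smu s) * (Smu s * star (Smu s) * (Snu s * star (Snu s))) * Snu s.
  rewrite !mulrA -[in LHS]hnu -{1}hmu !starM starK !mulrA.
  by [].
by rewrite PQ mulr0 mul0r.
Qed.

Lemma SS1 : star S * S = 1.
Proof.
case: gs => _ _ _ [h1 _] [h2 _ _].
rewrite /S starD mulrDl !mulrDr h1 h2 Smu_Snu_ortho.
have -> : star (Snu s) * Smu s = 0.
  by rewrite -[LHS]starK starM starK Smu_Snu_ortho star0.
by rewrite addr0 add0r pv_addpw.
Qed.

Lemma SSpv : S * star S = p.
Proof.
case: gs => _ _ _ [_ h] _; rewrite /S starD mulrDl !mulrDr.
have -> : Smu s * star (Snu s) = 0.
  by rewrite -SmuE -SnuE starM pw_star mulrA -(mulrA (Smu s)) pvpw mulr0 mul0r.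
have -> : Snu s * star (Smu s) = 0.
  by rewrite -SmuE -SnuE starM pv_star mulrA -(mulrA (Snu s)) pwpv mulr0 mul0r.
by rewrite addr0 add0r.
Qed.

Lemma Spv : S * p = Smu s.
Proof. by rewrite mulrDl SmuE -SnuE -mulrA pwpv mulr0 addr0. Qed.
Lemma Spw : S * w = Snu s.
Proof. by rewrite mulrDl SnuE -SmuE -mulrA pvpw mulr0 add0r. Qed.
Lemma pvS : p * S = S.
Proof. by rewrite -SSpv -mulrA SS1 mulr1. Qed.
Lemma pwE : w = 1 - S * star S.
Proof. by rewrite SSpv -pv_addpw addrC addKr. Qed.
Lemma pwS : w * S = 0.
Proof. by rewrite pwE mulrBl mul1r -mulrA SS1 mulr1 subrr. Qed.
Lemma Sstar_pw : star S * w = 0.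
Proof. by rewrite -pw_star -starM pwS star0. Qed.
Lemma SxiS : X * S = 0.
Proof. by rewrite -SxiE -mulrA pwS mulr0. Qed.
Lemma Sstar_Sxi : star S * X = 0.
Proof. by rewrite -pwSxi mulrA Sstar_pw mul0r. Qed.

Lemma SstarX_S k l : (l <= k)%N -> star S ^+ l * S ^+ k = S ^+ (k - l).
Proof.
elim: l k => [|l IHl] [|k]; rewrite ?mul1r ?subn0// => lk.
by rewrite exprSr exprS mulrA -(mulrA (_ ^+ l)) SS1 mulr1 IHl.
Qed.

Lemma SstarX_Sstar k l : (k <= l)%N -> star S ^+ l * S ^+ k = star S ^+ (l - k).
Proof.
elim: k l => [|k IHk] [|l]; rewrite ?mulr1 ?subn0// => lk.
by rewrite exprSr exprS mulrA -(mulrA (_ ^+ l)) SS1 mulr1 IHk.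
Qed.

Lemma SXX1 k : star S ^+ k * S ^+ k = 1.
Proof. by rewrite SstarX_S// subnn. Qed.

(** From S_mu = S p_v and p_v S = S: every p_v but the last is absorbed. *)
Lemma TvecE k : Tvec s k = S ^+ k * p.
Proof.
case: k => [|k]; first by rewrite mul1r.
elim: k => [|k IHk]; first by rewrite !expr1 Spv.
rewrite [Tvec _ _]exprS -/(Tvec s k.+1) IHk -Spv -mulrA (mulrA p).
rewrite [in RHS]exprS -[RHS]mulrA; congr (_ * (_ * _)).
by rewrite exprS mulrA pvS.
Qed.

Lemma TtildeE k : Ttilde s k = S ^+ k * w.
Proof.
case: k => [|k] /=; first by rewrite mul1r.
rewrite exprSr -mulrA Spw; case: k => [//|k].
by rewrite -[_ ^+ k.+1]/(Tvec s k.+1) TvecE -mulrA -Spw (mulrA p) pvS.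
Qed.

End CuntzKrieger.

(** * The grading given by the circle action *)

Section Homogeneous.
Context {R : realType} {A : cstarAlgType R} (s : graph_family A).
Variable sigma : R[i] -> {lrmorphism A -> A}.
Hypothesis gs : graph_relations s.
Hypothesis csigma : is_circle_action s sigma.
Local Notation S := (Sgen s).
Local Notation w := (pw s).
Local Notation X := (Sxi s).
Implicit Types (x y c : A) (d : int).

Definition hom d x := forall t : R, sigma (cis t) x = cis (d%:~R * t) *: x.

Lemma hom0 d : hom d 0.
Proof. by move=> t; rewrite linear0 scaler0. Qed.

Lemma hom1 : hom 0 1.
Proof. by move=> t; rewrite rmorph1 mul0r cis0 scale1r. Qed.

Lemma homD d x y : hom d x -> hom d y -> hom d (x + y).
Proof. by move=> hx hy t; rewrite linearD /= hx hy scalerDr. Qed.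

Lemma homZ d (c : R[i]) x : hom d x -> hom d (c *: x).
Proof. by move=> hx t; rewrite linearZ /= hx !scalerA mulrC. Qed.

Lemma homB d x y : hom d x -> hom d y -> hom d (x - y).
Proof. by move=> hx hy; rewrite -scaleN1r; apply/homD/homZ. Qed.

Lemma hom_sum d n (f : nat -> A) :
  (forall k, hom d (f k)) -> hom d (\sum_(0 <= k < n) f k).
Proof.
move=> hf; elim: n => [|n IHn]; first by rewrite big_geq//; apply: hom0.
by rewrite big_nat_recr//=; apply: homD.
Qed.

Lemma homM d d' x y : hom d x -> hom d' y -> hom (d + d') (x * y).
Proof.
move=> hx hy t; have -> : sigma (cis t) (x * y) = sigma (cis t) x * sigma (cis t) y.
  exact: rmorphM.
rewrite hx hy rmorphD mulrDl cisD.
by rewrite -scalerAl -scalerAr scalerA.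
Qed.

Lemma hom_star d x : hom d x -> hom (- d) (star x).
Proof.
move=> hx t; case: csigma => sm _ _ _ _.
by rewrite (sm _ (norm_cis t)) hx starZ conj_cis rmorphN mulNr.
Qed.

Lemma homX d x n : hom d x -> hom (d *+ n) (x ^+ n).
Proof.
move=> hx; elim: n => [|n IHn]; first exact: hom1.
by rewrite exprSr mulrSr; apply: homM.
Qed.

Lemma hom_S : hom 1 S.
Proof.
move=> t; case: csigma => _ _ _ _ /(_ _ (norm_cis t))[h1 h2 _].
by rewrite linearD /= h1 h2 mul1r scalerDr.
Qed.

Lemma hom_Sxi : hom 0 X.
Proof.
move=> t; case: csigma => _ _ _ _ /(_ _ (norm_cis t))[_ _ h3].
by rewrite h3 mul0r cis0 scale1r.
Qed.

Lemma hom_SX (n : nat) : hom n%:Z (S ^+ n).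
Proof. by have := homX n hom_S; rewrite natz. Qed.

Lemma hom_SstarX (n : nat) : hom (- n%:Z) (star S ^+ n).
Proof. by rewrite -starX; apply/hom_star/hom_SX. Qed.

Lemma hom_pw : hom 0 w.
Proof.
rewrite (pwE gs); apply: homB; first exact: hom1.
by have := homM hom_S (hom_star hom_S); rewrite subrr.
Qed.

Lemma hom_pv : hom 0 (pv s).
Proof. by rewrite -(SSpv gs); have := homM hom_S (hom_star hom_S); rewrite subrr. Qed.

(** The middle factor of a monomial is either absent or a degree-zero element of p_w A p_w, such as
    a power of S_xi. Nothing more about it is recorded, since p_w S = 0 is all that multiplication
    requires. *)
Definition corner_or1 c := c = 1 \/ [/\ hom 0 c, w * c = c & c * w = c].

Definition monomial x := x = 0 \/
  exists k l c, corner_or1 c /\ x = S ^+ k * c * star S ^+ l.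

Lemma monomial1 : monomial 1.
Proof. by right; exists 0%N, 0%N, 1; split; [left|rewrite !mulr1]. Qed.

Lemma monomial_star x : monomial x -> monomial (star x).
Proof.
case=> [->|[k [l [c [cP ->]]]]]; first by left; rewrite star0.
right; exists l, k, (star c); split; last by rewrite !starM !starX starK mulrA.
case: cP => [->|[hc wc cw]]; first by left; rewrite star1.
right; split; last 2 first.
- by rewrite -(pw_star gs) -starM cw.
- by rewrite -(pw_star gs) -starM wc.
by rewrite -[0]oppr0; apply: hom_star.
Qed.

Lemma corner_or1M c c' : corner_or1 c -> corner_or1 c' -> corner_or1 (c * c').
Proof.
move=> [->|[hc wc cw]]; first by rewrite mul1r.
move=> [->|[hc' wc' cw']]; first by rewrite mulr1; right.
right; split; [|by rewrite mulrA wc|by rewrite -mulrA cw'].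
by rewrite -[0]addr0; apply: homM.
Qed.

Lemma corner_S c n : corner_or1 c -> c = 1 \/ c * S ^+ n.+1 = 0.
Proof.
case=> [->|[_ _ cw]]; [by left|right].
by rewrite -cw exprS mulrA -(mulrA c) (pwS gs) mulr0 mul0r.
Qed.

Lemma Sstar_corner c n : corner_or1 c -> c = 1 \/ star S ^+ n.+1 * c = 0.
Proof.
case=> [->|[_ wc _]]; [by left|right].
by rewrite -wc exprSr -mulrA (mulrA (star S)) (Sstar_pw gs) mul0r mulr0.
Qed.

(** The inner product S^{*l} S^{k'} reduces to a power of S or of S^*. If that power is trivial, the
    middle factors multiply. Otherwise it is killed by an adjacent middle factor from the corner, or
    merges with an outer power when that middle factor is 1. *)
Lemma monomialM x y : monomial x -> monomial y -> monomial (x * y).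
Proof.
move=> [->|[k [l [c [cP ->]]]]]; first by left; rewrite mul0r.
move=> [->|[k' [l' [c' [cP' ->]]]]]; first by left; rewrite mulr0.
have [ll|ll] := leqP l k'.
  have -> : S ^+ k * c * star S ^+ l * (S ^+ k' * c' * star S ^+ l') =
      S ^+ k * (c * S ^+ (k' - l)) * c' * star S ^+ l'.
    by rewrite -(SstarX_S gs ll) !mulrA.
  case: (k' - l)%N => [|n].
    right; exists k, l', (c * c'); split; first exact: corner_or1M.
    by rewrite mulr1 !mulrA.
  case: (corner_S n cP) => ->; last by left; rewrite mulr0 !mul0r.
  by right; exists (k + n.+1)%N, l', c'; split=> //; rewrite mul1r exprD.
have -> : S ^+ k * c * star S ^+ l * (S ^+ k' * c' * star S ^+ l') =
    S ^+ k * c * (star S ^+ (l - k') * c') * star S ^+ l'.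
  by rewrite -(SstarX_Sstar gs (ltnW ll)) !mulrA.
case: (l - k')%N => [|n].
  right; exists k, l', (c * c'); split; first exact: corner_or1M.
  by rewrite mul1r !mulrA.
case: (Sstar_corner n cP') => ->; last by left; rewrite mulr0 !mul0r.
right; exists k, (n.+1 + l')%N, c; split=> //.
by rewrite mulr1 exprD !mulrA.
Qed.

(* This is where the corner by pw is seen to contain no element of positive
   degree. *)
Lemma monomial_hom x : monomial x -> exists d, hom d x /\
  forall m : nat, (m%:Z <= d)%R -> S ^+ m * star S ^+ m * x = x.
Proof.
case=> [->|[k [l [c [cP ->]]]]].
  by exists 0; split=> [|m _]; [apply: hom0|rewrite mulr0].
exists (k%:Z + 0 - l%:Z); split.
  apply: homM (hom_SstarX l); apply: homM; first exact: hom_SX.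
  by case: cP => [->|[]//]; apply: hom1.
(* The degree is k - l, so m <= k - l implies m <= k, and then S^m S^{*m} S^k = S^k. *)
move=> m mkl; have mk : (m <= k)%N by lia.
rewrite -!mulrA (mulrA (star S ^+ m)) (SstarX_S gs mk) !mulrA.
by rewrite -exprD subnKC.
Qed.

(** All generators are monomials: p_v = S S^*, S_mu = S p_v, S_nu = S p_w, while p_w and S_xi are
    themselves middle factors. *)
Lemma monomial_dense x : is_graph_algebra s -> approx (lspan monomial) x.
Proof.
case=> _ gen _; have lM u : monomial u -> lspan monomial u by apply: lspan_gen.
have mS : monomial S.
  by right; exists 1%N, 0%N, 1; split; [left|rewrite !mulr1].
have mw : monomial w.
  right; exists 0%N, 0%N, w; split; last by rewrite mulr1 mul1r.
  by right; rewrite (pw_idem gs); split=> //; apply: hom_pw.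
apply: (approx_lspan_generated gen).
- exact: monomial1.
- exact: monomialM.
- exact: monomial_star.
move=> u; case; [|case; [|case; [|case]]] => ->; apply: approx_sub; apply: lM.
- by rewrite -(SSpv gs); apply: monomialM => //; apply: monomial_star.
- by [].
- rewrite -(Spv gs) -(SSpv gs); apply: monomialM => //; apply: monomialM => //.
  exact: monomial_star.
- by rewrite -(Spw gs); apply: monomialM.
- right; exists 0%N, 0%N, X; split; last by rewrite mulr1 mul1r.
  by right; rewrite (pwSxi gs) (SxiE gs); split=> //; apply: hom_Sxi.
Qed.

End Homogeneous.

(** * Fourier components of homogeneous elements *)

Section FourierComponents.
Context {R : realType} {A : cstarAlgType R}.
Variable sigma : R[i] -> {lrmorphism A -> A}.

(** A geometric sum over the powers of om = exp(2 pi i d / n), an n-th root of unity that differs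
    from 1 because 0 < |d| < n. *)
Lemma sum_cis_uniform (d : int) (n : nat) : d != 0 -> (`|d| < n)%N ->
  \sum_(i < n) cis (d%:~R * (2 * pi * i%:R / n%:R)) = 0 :> R[i].
Proof.
move=> d0 dn; have n0 : (0 < n)%N by apply: leq_ltn_trans dn.
have nR0 : 0 < n%:R :> R by rewrite ltr0n.
have pi0 := pi_gt0 R; pose om : R[i] := cis (d%:~R * (2 * pi / n%:R)).
have om1 : om != 1.
  have th (e : nat) : (0 < e)%N -> (e < n)%N -> cis (e%:R * (2 * pi / n%:R)) != 1 :> R[i].
    move=> e0 en; apply: cis_neq1; rewrite mulr_gt0 ?divr_gt0 ?ltr0n ?mulr_gt0//=.
    by rewrite mulrA ltr_pdivrMr// mulrC ltr_pM2l ?mulr_gt0// ltr_nat.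
  case: d d0 dn @om => [e|e] d0 dn; first by apply: th => //; case: e d0 {dn}.
  rewrite NegzE rmorphN /= mulNr -conj_cis fmorph_eq1.
  exact: th.
have omn : om ^+ n = 1.
  rewrite cisX mulrCA [n%:R * _]mulrC divfK ?gt_eqF//; exact: cis_2pi.
have -> : \sum_(i < n) cis (d%:~R * (2 * pi * i%:R / n%:R)) = \sum_(i < n) om ^+ i.
  by apply: eq_bigr => i _; rewrite cisX; congr cis; rewrite mulrAC; ring.
apply/eqP; have /eqP := subrX1 om n; rewrite omn subrr eq_sym mulf_eq0 subr_eq0.
by rewrite (negPf om1).
Qed.

(** Uniform partitions with left end points as tags turn the Fourier integral into sums over roots
    of unity. *)
Lemma riemann_integral_uniform (f : R -> A) b I : 0 < b ->
  is_riemann_integral f 0 b I -> forall e, 0 < e -> exists N, forall n, (N < n)%N ->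
  cnorm (\sum_(i < n) (b / n%:R)%:C *: f (b * i%:R / n%:R) - I) < e.
Proof.
move=> b0 fI e /fI[d d0 dI]; have /archi_boundP : 0 <= b / d by rewrite divr_ge0 ?ltW.
set N := Num.bound _ => bd; exists N => n Nn.
have n0 : 0 < n%:R :> R by rewrite ltr0n; apply: leq_ltn_trans Nn.
pose t i : R := b * i%:R / n%:R.
have tS i : t i.+1 - t i = b / n%:R.
  by rewrite /t -mulrBl -mulrBr -natrB ?leqnSn// subSnn mulr1.
have t0 : t 0%N = 0 by rewrite /t mulr0 mul0r.
have tn : t n = b by rewrite /t mulfK ?gt_eqF.
have := dI n t t t0 tn.
have -> : \sum_(i < n) (t i.+1 - t i)%:C *: f (t i) =
   \sum_(i < n) (b / n%:R)%:C *: f (b * i%:R / n%:R).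
  by apply: eq_bigr => i _; rewrite tS.
apply=> i _; rewrite tS lexx -subr_ge0 tS divr_ge0 ?ltW//; split => //.
rewrite ltr_pdivrMr// mulrC -ltr_pdivrMr//; apply: lt_trans bd _.
by rewrite ltr_nat.
Qed.

(** On a homogeneous element the uniform Riemann sums are constant once n > |d - m|, so the integral
    is read off without any computation of limits. *)
Lemma fourier_component_hom Phi (m d : int) x :
  is_fourier_component sigma Phi -> hom sigma d x ->
  Phi m x = if d == m then x else 0.
Proof.
move=> fP hx; have pi0 := pi_gt0 R; have pi20 : 0 < 2 * pi :> R by rewrite mulr_gt0.
have [I fI ->] := fP m x.
have sumE n : \sum_(i < n) (2 * pi / n%:R)%:C *:
    (cis (- (m%:~R * (2 * pi * i%:R / n%:R))) *: sigma (cis (2 * pi * i%:R / n%:R)) x) =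
    ((2 * pi / n%:R)%:C * \sum_(i < n) cis ((d - m)%:~R * (2 * pi * i%:R / n%:R))) *: x.
  rewrite -scaler_sumr -scalerA scaler_suml; congr (_ *: _); apply: eq_bigr => i _.
  by rewrite hx scalerA -cisD -mulNr -mulrDl rmorphB /= addrC.
have IE : I = (if d == m then (2 * pi)%:C else 0) *: x.
  apply/eqP; rewrite eq_sym -subr_eq0; apply/eqP/cnorm_small => e e0.
  have [N NI] := riemann_integral_uniform pi20 fI e0.
  pose n := (N + `|(d - m)%R|).+1; have := NI n ltac:(by rewrite ltnS leq_addr).
  rewrite sumE; have [dm|dm] := eqVneq d m.
    rewrite dm subrr; under eq_bigr do rewrite mul0r cis0.
    rewrite sumr_const card_ord -(rmorph_nat (real_complex R)) -rmorphM.
    by rewrite divfK ?pnatr_eq0.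
  by rewrite sum_cis_uniform ?subr_eq0 ?ltnS ?leq_addl// mulr0.
rewrite IE; case: ifP => _; last by rewrite scale0r scaler0.
by rewrite scalerA -rmorphM mulVf ?gt_eqF// scale1r.
Qed.

End FourierComponents.

(** * The Haar state *)

Section HaarState.
Context {R : realType} {A : cstarAlgType R} (s : graph_family A) (q : R) (a b : A).
Variable h : {scalar A}.
Hypothesis q01 : 0 < q < 1.
Hypothesis gs : graph_relations s.
Hypothesis ab : is_CSUq2 q a b.
Hypothesis abs : suq2_graph_identification q s a b.
Hypothesis haar : is_haar_state q a b h.
Local Notation S := (Sgen s).
Local Notation w := (pw s).
Local Notation X := (Sxi s).
Implicit Types (x y z : A).

Let h_ge0 x : 0 <= h (star x * x). Proof. by case: haar. Qed.
Let h1 : h 1 = 1. Proof. by case: haar. Qed.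

Lemma cnorm_S : cnorm S = 1.
Proof.
have := cnorm_star S; rewrite (SS1 gs) cnorm1 => /esym/eqP.
by rewrite sqrp_eq1 ?cnorm_ge0// => /eqP.
Qed.

(** The partial sums of the series for [b] satisfy u_{n+1} = S_xi + q S u_n S^*, and the right-hand
    side is Lipschitz in u_n because |S| = 1. *)
Lemma b_fixpoint : b = X + q%:C *: (S * b * star S).
Proof.
have [q0 q1] := andP q01; apply/eqP; rewrite -subr_eq0; apply/eqP/cnorm_small => e e0.
case: abs => _ /cnorm_cvgP/(_ (e / 2) ltac:(lra)) [N Nb].
pose u n := \sum_(0 <= k < n) (q ^+ k)%:C *: (S ^+ k * X * star S ^+ k).
have uE n : u n.+1 = X + q%:C *: (S * u n * star S).
  rewrite /u big_nat_recl// expr0 mul1r mulr1 scale1r; congr (_ + _).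
  rewrite mulr_sumr mulr_suml scaler_sumr; apply: eq_bigr => i _.
  by rewrite exprS [S ^+ _]exprS [star S ^+ _]exprSr -scalerAr -scalerAl scalerA rmorphM !mulrA.
have {}Nb n : (N <= n)%N -> cnorm (u n - b) < e / 2.
  by move=> /Nb; rewrite -starD.
have := ler_cnorm_dist (u N.+1) b (X + q%:C *: (S * b * star S)).
rewrite (cnormBC b (u N.+1)); have := Nb N.+1 (leqnSn _).
have -> : u N.+1 - (X + q%:C *: (S * b * star S)) = q%:C *: (S * (u N - b) * star S).
  by rewrite uE opprD addrACA subrr add0r -scalerBr mulrBr mulrBl.
rewrite cnormZr gtr0_norm//; have := Nb N (leqnn _).
have := ler_cnormM (S * (u N - b)) (star S); have := ler_cnormM S (u N - b).
rewrite cnorm_starE cnorm_S mulr1 mul1r.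
have := ler_piMl (cnorm_ge0 (S * (u N - b) * star S)) (ltW q1); lra.
Qed.

(** The mixed terms vanish by S_xi S = 0 and S^* S_xi = 0. The exponent is positive because the
    zeroth power of S_xi is 1, not p_w. *)
Lemma bX_fixpoint n : b ^+ n.+1 = X ^+ n.+1 + (q ^+ n.+1)%:C *: (S * b ^+ n.+1 * star S).
Proof.
elim: n => [|n IHn]; first exact: b_fixpoint.
rewrite exprS {1}b_fixpoint {1}IHn mulrDl !mulrDr -exprS.
rewrite -scalerAr -!scalerAl -!scalerAr scalerA.
rewrite [X * (S * _ * _)]mulrA [X * (S * _)]mulrA (SxiS gs) !mul0r scaler0 addr0.
rewrite {1}[X ^+ n.+1]exprS -(mulrA _ (star S)) (mulrA (star S)) (Sstar_Sxi gs) mul0r mulr0.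
rewrite scaler0 add0r; congr (_ + _ *: _); first by rewrite -rmorphM -exprS.
by rewrite -!mulrA (mulrA (star S) S) (SS1 gs) mul1r.
Qed.

Lemma starX_SxiX n : star X ^+ n.+1 * X ^+ n.+1 = w.
Proof.
elim: n => [|n IHn]; first by have [] := Sxi_unitary gs.
rewrite exprSr [X ^+ n.+2]exprS mulrA -(mulrA (_ ^+ n.+1)); have [-> _] := Sxi_unitary gs.
by rewrite -mulrA [X ^+ _]exprS (mulrA w) (pwSxi gs) -exprS.
Qed.

Lemma bstarX_bX n : star b ^+ n.+1 * b ^+ n.+1 =
  w + (q ^+ (2 * n.+1))%:C *: (S * (star b ^+ n.+1 * b ^+ n.+1) * star S).
Proof.
rewrite -!starX; set B := b ^+ n.+1.
have BE : B = X ^+ n.+1 + (q ^+ n.+1)%:C *: (S * B * star S) by exact: bX_fixpoint.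
set C := X ^+ n.+1 in BE; set D := S * B * star S in BE.
have CS : star C * S = 0.
  by rewrite starX exprSr -mulrA -[star X * S]starK starM starK (Sstar_Sxi gs) star0 mulr0.
have CD : star C * D = 0 by rewrite /D !mulrA CS !mul0r.
have DC : star D * C = 0 by rewrite -[LHS]starK starM starK CD star0.
have DD : star D * D = S * (star B * B) * star S.
  by rewrite /D !starM starK -!mulrA (mulrA (star S) S) (SS1 gs) mul1r.
have CC : star C * C = w by rewrite /C starX starX_SxiX.
rewrite {1 2}BE starD starZ [Num.conj _]conjc_real mulrDl !mulrDr -!scalerAl -!scalerAr.
rewrite CD DC DD CC !scaler0 addr0 add0r scalerA -rmorphM -exprD.
by rewrite mul2n addnn.
Qed.

(** By a^* a + b^* b = 1 the difference of the two sides is the value of [h] at (a y)^* (a y). *)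
Lemma haar_relation_le y : h (star y * (star b * b) * y) <= h (star y * y).
Proof.
have [[_ ab1 _ _ _] _ _] := ab; rewrite -subr_ge0 -linearB /=.
have -> : star y * y - star y * (star b * b) * y = star (a * y) * (a * y).
  have -> : star y * y = star y * (star a * a + star b * b) * y by rewrite ab1 mulr1.
  by rewrite mulrDr mulrDl addrK starM !mulrA.
exact: h_ge0.
Qed.

Lemma haar_bX_le n y : h (star (b ^+ n * y) * (b ^+ n * y)) <= h (star y * y).
Proof.
elim: n => [|n IHn]; first by rewrite mul1r.
apply: le_trans IHn; have := haar_relation_le (b ^+ n * y).
by rewrite exprS !starM !mulrA.
Qed.

Lemma haar_bX n : h (star (b ^+ n) * b ^+ n) = ((1 - q ^+ 2) / (1 - q ^+ (2 * n + 2)))%:C.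
Proof. by case: haar => _ _ _ <-; rewrite starX. Qed.

Definition haar_corner k : R := complex.Re (h (S ^+ k * w * star S ^+ k)).

Lemma haar_cornerE k : h (S ^+ k * w * star S ^+ k) = (haar_corner k)%:C.
Proof.
rewrite /haar_corner RRe_real// ger0_real//.
have -> : S ^+ k * w * star S ^+ k = star (w * star S ^+ k) * (w * star S ^+ k).
  by rewrite starM starX starK (pw_star gs) !mulrA -(mulrA _ w w) (pw_idem gs).
exact: h_ge0.
Qed.

Lemma S_projS k : S ^+ k.+1 * star S ^+ k.+1 = S ^+ k * star S ^+ k - S ^+ k * w * star S ^+ k.
Proof.
rewrite (pwE gs) mulrBr mulr1 mulrBl opprB addrC subrK.
by rewrite exprSr exprS !mulrA.
Qed.

Lemma haar_SX_le1 k : h (S ^+ k * star S ^+ k) <= 1.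
Proof.
elim: k => [|k IHk]; first by rewrite mulr1 h1.
rewrite S_projS linearB /= (le_trans _ IHk)// gerBl haar_cornerE.
have := h_ge0 (w * star S ^+ k); rewrite starM starX starK (pw_star gs).
by rewrite !mulrA -(mulrA _ w w) (pw_idem gs) haar_cornerE.
Qed.

(** For y = b^{*(n+1)} b^{n+1}, the relation y = p_w + q^{2(n+1)} S y S^* is iterated K times. The
    remainder is r = h(S^K y S^{*K}); it lies in [0, 1] because b^* b <= 1 under [h]. Keeping it
    explicit avoids any infinite series of weights. *)
Lemma haar_moment n K : exists2 r : R, 0 <= r <= 1 &
  (1 - q ^+ 2) / (1 - q ^+ (2 * n.+1 + 2)) =
  \sum_(i < K) q ^+ (2 * n.+1 * i) * haar_corner i + q ^+ (2 * n.+1 * K) * r.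
Proof.
pose B := star (b ^+ n.+1) * b ^+ n.+1.
pose rK k := complex.Re (h (S ^+ k * B * star S ^+ k)).
have rE k : h (S ^+ k * B * star S ^+ k) = (rK k)%:C.
  rewrite /rK RRe_real// ger0_real//.
  have -> : S ^+ k * B * star S ^+ k = star (b ^+ n.+1 * star S ^+ k) * (b ^+ n.+1 * star S ^+ k).
    by rewrite !starM [star (star _ ^+ _)]starX starK !mulrA.
  exact: h_ge0.
exists (rK K).
  rewrite -ler0c -(lecR _ 1) -rE; apply/andP; split.
    have := h_ge0 (b ^+ n.+1 * star S ^+ K).
    by rewrite !starM [star (star _ ^+ _)]starX starK !mulrA.
  apply: le_trans (haar_SX_le1 K).
  have := haar_bX_le n.+1 (star S ^+ K).
  by rewrite !starM [star (star _ ^+ _)]starX starK !mulrA.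
have rS k : rK k = haar_corner k + q ^+ (2 * n.+1) * rK k.+1.
  apply: complexI; rewrite rmorphD rmorphM /= -!rE -haar_cornerE.
  have BE : B = w + (q ^+ (2 * n.+1))%:C *: (S * B * star S).
    by rewrite /B starX; exact: bstarX_bX.
  rewrite {1}BE mulrDr mulrDl linearD -scalerAr -scalerAl linearZ /=.
  by rewrite exprSr [star S ^+ k.+1]exprS !mulrA.
have -> : (1 - q ^+ 2) / (1 - q ^+ (2 * n.+1 + 2)) = rK 0%N.
  by apply: complexI; rewrite -haar_bX -/B -rE mul1r mulr1.
elim: K => [|K ->]; first by rewrite big_ord0 add0r muln0 expr0 mul1r.
rewrite big_ord_recr /= -addrA {1}rS; congr (_ + _).
by rewrite mulrDr mulrA -exprD -mulnSr.
Qed.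

(* Comparing the moments with those of the geometric weights (1-q^2) q^(2k),
   the first differing weight would dominate as n tends to infinity. *)
Lemma haar_corner_val k : haar_corner k = (1 - q ^+ 2) * q ^+ (2 * k).
Proof.
have [q0 q1] := andP q01.
elim/ltn_ind: k => K IH; set y := q ^+ 2; have qy i : q ^+ (2 * i) = y ^+ i by rewrite exprM.
have y0 : 0 < y by rewrite exprn_gt0.
have y1 : y < 1 by rewrite exprn_ilt1// ltW.
(* With the weights below K known, the moment identity cut after K + 1 terms and divided by x^K,
   where x = y^{n+1}, determines the weight K up to an error of size x. The moment (1 - y) / (1 - x
   y) is the generating function at x of the geometric weights. *)
have bound n : `|haar_corner K - (1 - y) * y ^+ K| <= y ^+ n.+1.
  have [r r01] := haar_moment n K.+1; rewrite big_ord_recr /=.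
  set x := y ^+ n.+1; have qx i : q ^+ (2 * n.+1 * i) = x ^+ i by rewrite exprM qy.
  have x0 : 0 < x by rewrite exprn_gt0.
  have x1 : x < 1 by rewrite exprn_ilt1// ltW.
  have -> : q ^+ (2 * n.+1 + 2) = x * y by rewrite exprD qy.
  have -> : \sum_(i < K) q ^+ (2 * n.+1 * i) * haar_corner i =
      (1 - y) * \sum_(i < K) (x * y) ^+ i.
    rewrite mulr_sumr; apply: eq_bigr => i _; rewrite IH// qx qy -/y [in RHS]exprMn.
    by rewrite mulrCA.
  have xy1 : x * y < 1 by nra.
  have xy0 : 0 < x * y by rewrite mulr_gt0.
  have xyK : \sum_(i < K) (x * y) ^+ i = (1 - (x * y) ^+ K) / (1 - x * y).
    apply: (canRL (mulfK _)); first by rewrite subr_eq0 gt_eqF.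
    by rewrite mulrC -opprB mulNr -subrX1 opprB.
  rewrite xyK !qx (exprS x K) (exprMn K x y) -/y => E.
  have xK0 : x ^+ K != 0 by rewrite expf_neq0// gt_eqF.
  have {}E : (1 - y) * y ^+ K / (1 - x * y) = haar_corner K + x * r.
    apply: (mulfI xK0).
    transitivity ((1 - y) / (1 - x * y) - (1 - y) * ((1 - x ^+ K * y ^+ K) / (1 - x * y))).
      by field; rewrite subr_eq0 gt_eqF.
    by rewrite E; ring.
  have yK0 : 0 < y ^+ K by rewrite exprn_gt0.
  have yK1 : y ^+ K <= 1 by rewrite exprn_ile1 ?ltW.
  have {}E : haar_corner K - (1 - y) * y ^+ K = x * ((1 - y) * y ^+ K.+1 / (1 - x * y) - r).
    rewrite mulrBr [RHS]addrC; apply/eqP; rewrite subr_eq addrC; apply/eqP.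
    rewrite -[haar_corner K](addrK (x * r)) -E exprS; field.
    by rewrite subr_eq0 gt_eqF.
  (* The scaled tail of the geometric series and the remainder r both lie in [0, 1], so their
     difference has absolute value at most 1. *)
  have z1 : 0 <= (1 - y) * y ^+ K.+1 / (1 - x * y) <= 1.
    have d0 : 0 < 1 - x * y by lra.
    have yS0 : 0 < y ^+ K.+1 by rewrite exprn_gt0.
    rewrite ler_pdivrMr// mul1r divr_ge0 ?(ltW d0)//; last by nra.
    have yS1 : y ^+ K.+1 <= 1 by rewrite exprn_ile1 ?ltW.
    have xyy : x * y <= y by rewrite ler_piMl ?ltW.
    by nra.
  rewrite E normrM (gtr0_norm x0); apply: ler_piMr; first exact: ltW.
  rewrite ler_norml.
  by move: r01 z1; lra.
rewrite qy; apply/eqP; rewrite -subr_eq0 -normr_eq0 eq_le normr_ge0 andbT.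
apply/ler_addgt0Pr => e e0; rewrite add0r.
have : y ^+ n @[n --> \oo] --> 0 by apply: cvg_expr; rewrite gtr0_norm.
move=> /cvgrPdist_lt/(_ e e0)[N _ Nr]; have yN : y ^+ N.+1 < e.
  by have := Nr N.+1 (leqnSn _); rewrite /= sub0r normrN ger0_norm ?exprn_ge0// ltW.
exact: le_trans (bound N) (ltW yN).
Qed.

Lemma haar_SX k : h (S ^+ k * star S ^+ k) = (q ^+ (2 * k))%:C.
Proof.
elim: k => [|k IHk]; first by rewrite mulr1 h1.
rewrite S_projS linearB /= IHk haar_cornerE haar_corner_val -rmorphB.
by congr _%:C; rewrite mulnS exprD; ring.
Qed.

End HaarState.

(** * Invariance of the Haar state under the circle action *)

Section HaarInvariance.
Context {R : realType} {A : cstarAlgType R} (s : graph_family A) (q : R) (a b : A).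
Variables (h : {scalar A}) (sigma : R[i] -> {lrmorphism A -> A}).
Hypothesis gs : graph_relations s.
Hypothesis ab : is_CSUq2 q a b.
Hypothesis abs : suq2_graph_identification q s a b.
Hypothesis haar : is_haar_state q a b h.
Hypothesis csigma : is_circle_action s sigma.
Local Notation S := (Sgen s).
Local Notation hom := (hom sigma).
Implicit Types (x y z : A) (d : int) (t : R).

(** States are bounded, so an identity between them passes to norm limits. The phase c serves for
    homogeneous approximants, where f y = c g y; with c = 1 it gives equality on all of A. *)
Lemma states_agree (f g : {scalar A}) (c : R[i]) x :
  (forall x, 0 <= f (star x * x)) -> f 1 = 1 ->
  (forall x, 0 <= g (star x * x)) -> g 1 = 1 -> `|c| = 1 ->
  approx [set y | f y = c * g y] x -> f x = c * g x.
Proof.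
move=> f0 f1 g0 g1 c1 xP; apply/eqP; rewrite -subr_eq0 -normr_eq0.
have nE : `|f x - c * g x| = (complex.Re `|f x - c * g x|)%:C by rewrite normc_def.
rewrite nE; suff -> : complex.Re `|f x - c * g x| = 0 by [].
apply/eqP; rewrite eq_le; apply/andP; split; last by rewrite -ler0c -nE normr_ge0.
apply/ler_addgt0Pr => e e0; rewrite -lecR -nE add0r.
(* A quarter of e, because [state_norm] loses a factor 2 for each of the two states. *)
have [y fgy xy] := xP (e / 2 / 2) ltac:(lra).
have -> : f x - c * g x = f (x - y) - c * g (x - y).
  by rewrite !linearB mulrBr fgy /= opprB addrA subrK.
apply: le_trans (ler_normB _ _) _; rewrite normrM c1 mul1r.
have := state_norm f0 f1 xy; have := state_norm g0 g1 xy.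
by rewrite mulr2n -splitr => le1 le2; rewrite [e]splitr rmorphD lerD.
Qed.

Lemma a_homogeneous : approx (hom (-1)) a.
Proof.
case: abs => au _; apply: (approx_cvg _ au) => n; apply: hom_sum => k.
rewrite -starD; apply: homZ.
have -> : -1 = k%:Z - k.+1%:Z by lia.
exact: homM (hom_SX csigma k) (hom_SstarX csigma k.+1).
Qed.

Lemma b_homogeneous : approx (hom 0) b.
Proof.
case: abs => _ bu; apply: (approx_cvg _ bu) => n; apply: hom_sum => k.
rewrite -starD; apply: homZ.
have := homM (homM (hom_SX csigma k) (hom_Sxi csigma)) (hom_SstarX csigma k).
by rewrite addr0 subrr.
Qed.

Definition word_val (u : seq suq2_letter) : A := \prod_(l <- u) letter_val a b l.

(** The first component of the bidegree is the degree for [sigma], since a has degree -1 and b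
    degree 0. *)
Lemma word_homogeneous u : approx (hom (\sum_(l <- u) letter_deg l).1) (word_val u).
Proof.
have star_hom d : forall y, hom d y -> hom (- d) (star y) by move=> y; apply: (hom_star csigma).
elim: u => [|l u IHu]; first by rewrite /word_val !big_nil; apply: approx_sub; exact: (hom1 sigma).
rewrite /word_val !big_cons; apply: approxM IHu; first by move=> y z; apply: homM.
case: l => /=.
- exact: a_homogeneous.
- by rewrite -[1]opprK; apply: approx_star a_homogeneous; apply: star_hom.
- exact: b_homogeneous.
- by rewrite -[0]oppr0; apply: approx_star b_homogeneous; apply: star_hom.
Qed.

Lemma word_dense x : approx (lspan (range word_val)) x.
Proof.
case: ab => _ gen _; apply: (approx_lspan_generated gen).
- by exists [::]; rewrite // /word_val big_nil.
- move=> _ _ [u _ <-] [v _ <-]; exists (u ++ v) => //.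
  by rewrite /word_val big_cat.
- pose bar l := match l with La => Lastar | Lastar => La | Lb => Lbstar | Lbstar => Lb end.
  move=> _ [u _ <-]; exists (rev (map bar u)) => //.
  elim: u => [|l u IHu]; first by rewrite /word_val !big_nil star1.
  rewrite /= rev_cons /word_val -cats1 big_cat big_seq1 big_cons starM -IHu.
  by congr (_ * _); case: l => //=; rewrite starK.
- move=> _ [|] ->; apply/approx_sub/lspan_gen.
    by exists [:: La]; rewrite // /word_val big_seq1.
  by exists [:: Lb]; rewrite // /word_val big_seq1.
Qed.

(* No continuity of sigma (cis t) is needed: the composite h o sigma (cis t) is
   again a state, hence bounded, and words in a, b are limits of homogeneous
   elements. *)
Lemma haar_invariant t x : h (sigma (cis t) x) = h x.
Proof.
have h0 y : 0 <= h (star y * y) by case: haar.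
have h1 : h 1 = 1 by case: haar.
pose f : {scalar A} := h \o sigma (cis t).
have f0 y : 0 <= f (star y * y).
  have -> : f (star y * y) = h (star (sigma (cis t) y) * sigma (cis t) y).
    rewrite /f /=; case: csigma => /(_ _ (norm_cis t)) sm _ _ _ _.
    have E : sigma (cis t) (star y * y) = sigma (cis t) (star y) * sigma (cis t) y.
      exact: rmorphM.
    by rewrite E sm.
  exact: h0.
have f1 : f 1 = 1 by rewrite /f /= rmorph1.
have fword u : f (word_val u) = h (word_val u).
  set d := (\sum_(l <- u) letter_deg l).1.
  have -> : f (word_val u) = cis (d%:~R * t) * h (word_val u).
    apply: (states_agree f0 f1 h0 h1 (norm_cis _)).
    apply: approxS (@word_homogeneous u) => y hy.
    by rewrite /= /f /= hy linearZ.
  (* In degree 0 the phase is 1; otherwise the bidegree of the word is nonzero and [h] vanishes on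
     it. *)
  have [d0|d0] := eqVneq d 0; first by rewrite d0 mul0r cis0 mul1r.
  have -> : h (word_val u) = 0; last by rewrite mulr0.
  case: haar => _ _ hw _; apply: hw => E; move: d0.
  by rewrite /d E eqxx.
rewrite -[RHS]mul1r -[LHS]/(f x); apply: (states_agree f0 f1 h0 h1 (normr1 _)).
apply: approxS (word_dense x) => y yP; rewrite /= mul1r.
elim: yP => [|c _ z [u _ <-] _ IH]; first by rewrite !linear0.
by rewrite !linearP IH /= -[h (sigma _ _)]/(f _) fword.
Qed.

(** Invariance at the angle pi / d, where the phase is -1, gives h x = - h x. *)
Lemma haar_hom_eq0 d x : d != 0 -> hom d x -> h x = 0.
Proof.
move=> d0 hx; have := haar_invariant (pi / d%:~R) x.
rewrite hx linearZ /= [d%:~R * _]mulrC divfK ?intr_eq0// /cis cospi sinpi.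
have -> : (-1 +i* 0)%C = -1 :> R[i] by simpc.
rewrite mulN1r => /eqP; rewrite eq_sym -addr_eq0 -mulr2n mulrn_eq0.
by move/eqP.
Qed.

End HaarInvariance.

(** * Diagonal operators on a Hilbert space *)

Section LinearMaps.
Context {R : realType} {H : completeNormedModType R[i]} (T : H -> H).
Hypothesis lT : linear T.

Lemma opD x y : T (x + y) = T x + T y.
Proof. by rewrite -[x]scale1r lT !scale1r. Qed.

Lemma op0 : T 0 = 0.
Proof. by apply: (addrI (T 0)); rewrite -opD !addr0. Qed.

Lemma opZ (c : R[i]) x : T (c *: x) = c *: T x.
Proof. by rewrite -[c *: x]addr0 lT op0 addr0. Qed.

Lemma opB x y : T (x - y) = T x - T y.
Proof. by rewrite opD -[- y]scaleN1r opZ scaleN1r. Qed.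

Lemma op_sum I (r : seq I) (P : pred I) (F : I -> H) :
  T (\sum_(i <- r | P i) F i) = \sum_(i <- r | P i) T (F i).
Proof. exact: (big_morph T opD op0). Qed.

End LinearMaps.

Section BoundedOps.
Context {R : realType} {H : completeNormedModType R[i]}.
Implicit Types T U : H -> H.

Lemma bounded_op_comp T U : bounded_op T -> bounded_op U -> bounded_op (fun x => T (U x)).
Proof.
move=> [lT cT] [lU cU]; split=> [c x y|x]; first by rewrite lU lT.
exact: (continuous_comp (cU x) (cT (U x))).
Qed.

Lemma bounded_op0 : bounded_op (fun=> 0 : H).
Proof. by split=> [c x y|x]; [rewrite scaler0 addr0|exact: cst_continuous]. Qed.

Lemma bounded_op_sub T U : bounded_op T -> bounded_op U -> bounded_op (fun x => T x - U x).
Proof.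
move=> [lT cT] [lU cU]; split=> [c x y|x]; last exact: (cvgB (cT x) (cU x)).
by rewrite lU lT scalerBr opprD addrACA.
Qed.

End BoundedOps.

(** * Elementary Hilbert space theory *)

Section HilbertTheory.
Context {R : realType} {H : completeNormedModType R[i]}.
Variable dot : {dot H for Num.conj}.
Hypothesis hn : hilbert_norm dot.
Implicit Types (x y z : H) (c : R[i]).
Local Notation ip := (ip dot).
Local Notation Re := (@complex.Re R).

(** The norm of [H] takes values in [R[i]]; its real part is the same number in [R], where the order
    is total and real analysis applies. *)
Definition hnorm x : R := complex.Re `|x|.

Lemma hnormE x : `|x| = (hnorm x)%:C.
Proof. by rewrite /hnorm RRe_real// ger0_real. Qed.

Lemma hnorm_ge0 x : 0 <= hnorm x.
Proof. by rewrite -ler0c -hnormE normr_ge0. Qed.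

Lemma hnorm0 : hnorm 0 = 0.
Proof. by rewrite /hnorm normr0. Qed.

Lemma ipC x y : ip x y = Num.conj (ip y x).
Proof. by rewrite /ip hermC expr0 mul1r. Qed.

Lemma ipDr x y z : ip x (y + z) = ip x y + ip x z.
Proof. exact: linearDl. Qed.

Lemma ipDl x y z : ip (x + y) z = ip x z + ip y z.
Proof. exact: linearDr. Qed.

Lemma ipZr x c y : ip x (c *: y) = c * ip x y.
Proof. exact: linearZl_LR. Qed.

Lemma ipZl x c y : ip (c *: x) y = Num.conj c * ip x y.
Proof. exact: linearZr_LR. Qed.

Lemma ip0r x : ip x 0 = 0.
Proof. exact: linear0l. Qed.

Lemma ip0l x : ip 0 x = 0.
Proof. by rewrite ipC ip0r rmorph0. Qed.

Lemma ipBr x y z : ip x (y - z) = ip x y - ip x z.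
Proof. exact: linearBl. Qed.

Lemma ipBl x y z : ip (x - y) z = ip x z - ip y z.
Proof. exact: linearBr. Qed.

Lemma ip_sumr x I (r : seq I) (F : I -> H) :
  ip x (\sum_(i <- r) F i) = \sum_(i <- r) ip x (F i).
Proof. exact: (big_morph _ (ipDr x) (ip0r x)). Qed.

Lemma ip_hnorm x : ip x x = (hnorm x ^+ 2)%:C.
Proof. by rewrite -hn hnormE rmorphXn. Qed.

Lemma hnormZr (r : R) x : hnorm (r%:C *: x) = `|r| * hnorm x.
Proof.
apply: complexI; rewrite rmorphM -hnormE /= normrZ hnormE; congr (_ * _).
by rewrite normc_def /= expr0n addr0 sqrtr_sqr.
Qed.

Lemma hnorm_pythagoras x y : ip x y = 0 -> hnorm (x + y) ^+ 2 = hnorm x ^+ 2 + hnorm y ^+ 2.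
Proof.
move=> xy; have yx : ip y x = 0 by rewrite ipC xy rmorph0.
by apply: complexI; rewrite rmorphD /= -!ip_hnorm ipDl !ipDr xy yx addr0 add0r.
Qed.

(** Pythagoras for the decomposition of x into its component c y along y and the orthogonal rest
    gives |c y| <= |x|. *)
Lemma cauchy_schwarz x y : `|ip x y| <= `|x| * `|y|.
Proof.
have [->|y0] := eqVneq y 0; first by rewrite ip0r !normr0 mulr0.
have ny : 0 < `|y| ^+ 2 by rewrite exprn_gt0 ?normr_gt0.
pose c := ip y x / ip y y.
have orth : ip (x - c *: y) (c *: y) = 0.
  rewrite ipZr ipBl ipZl.
  have -> : Num.conj c = ip x y / ip y y :> R[i].
    by rewrite (ipC x y) [in RHS](ipC y y) /c rmorphM fmorphV.
  by rewrite divfK ?subrr ?mulr0// -hn gt_eqF.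
have := hnorm_pythagoras orth; rewrite subrK => E.
have le : hnorm (c *: y) ^+ 2 <= hnorm x ^+ 2 by rewrite E lerDr sqr_ge0.
have {le} : `|c *: y| <= `|x|.
  rewrite -(@ler_pXn2r _ 2)// ?nnegrE//.
  by rewrite !hnormE -!rmorphXn lecR.
rewrite normrZ /c normf_div -hn normrX normr_id expr2 invfM mulrA divfK ?normr_eq0//.
by rewrite ler_pdivrMr ?normr_gt0// ipC norm_conjC.
Qed.

(** The imaginary part of <x, y> is the real part of <i x, y>. Limits of inner products can thus be
    taken in [R] only. *)
Lemma ip_Re_ext x y x' y' : Re (ip x y) = Re (ip x' y') ->
  Re (ip ('i *: x) y) = Re (ip ('i *: x') y') -> ip x y = ip x' y'.
Proof.
have ImE u v : Re (ip ('i *: u) v) = complex.Im (ip u v).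
  by rewrite ipZl; case: (ip u v) => r m; rewrite /= mul0r sub0r mulN1r opprK.
rewrite !ImE; case: (ip x y) => r m; case: (ip x' y') => r' m' /= -> ->.
by [].
Qed.

Lemma ip_Re_cvg y (u : nat -> H) x : u n @[n --> \oo] --> x ->
  Re (ip y (u n)) @[n --> \oo] --> Re (ip y x).
Proof.
move=> /cvgrPdist_lt ux; apply/cvgrPdist_lt => e e0.
have y1 : 0 < hnorm y + 1 by rewrite ltr_wpDl ?hnorm_ge0.
have ey : 0 < (e / (hnorm y + 1))%:C :> R[i] by rewrite ltcR divr_gt0.
have := ux _ ey; apply: filterS => n.
rewrite hnormE ltcR ltr_pdivlMr// => xn; apply: le_lt_trans xn.
rewrite -raddfB /= -ipBr -lecR; apply: le_trans (normc_ge_Re _) _.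
apply: le_trans (cauchy_schwarz _ _) _; rewrite !hnormE -rmorphM lecR mulrC.
by rewrite ler_wpM2l ?hnorm_ge0// lerDl.
Qed.

Lemma contraction_bounded T : linear T -> (forall x, hnorm (T x) <= hnorm x) -> bounded_op T.
Proof.
move=> lT cT; split=> // x; apply/cvgrPdist_lt => e e0.
have /cvgrPdist_lt/(_ e e0) : y @[y --> x] --> x by exact: cvg_id.
apply: filterS => y; apply: le_lt_trans.
by rewrite -opB// !hnormE lecR.
Qed.

Lemma proj_hnorm_le E x : linear E -> (forall x, E (E x) = E x) ->
  adjoint_op dot E E -> hnorm (E x) <= hnorm x.
Proof.
move=> lE EE aE; rewrite -(@ler_pXn2r _ 2)// ?nnegrE ?hnorm_ge0//.
have orth : ip (E x) (x - E x) = 0 by rewrite aE opB// EE subrr ip0r.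
have := hnorm_pythagoras orth; rewrite [E x + _]addrC subrK => ->.
by rewrite lerDl sqr_ge0.
Qed.

(** An e/3 argument: for uniformly bounded operators, convergence on a dense set gives convergence
    everywhere. *)
Lemma contraction_cvg (T : nat -> H -> H) (V : set H) : dense V ->
  (forall n, linear (T n)) -> (forall n x, hnorm (T n x) <= hnorm x) ->
  (forall x, V x -> T n x @[n --> \oo] --> x) ->
  forall x, T n x @[n --> \oo] --> x.
Proof.
move=> dV lT cT VT x; apply/cvgrPdist_lt => e e0.
have e3 : 0 < e / 3 by rewrite divr_gt0.
have [||y [/= xy Vy]] := dV (ball x (e / 3)).
- by exists x; apply: ballxx.
- exact: ball_open.
have /cvgrPdist_lt/(_ _ e3) := VT y Vy; apply: filterS => n yn.
have -> : x - T n x = (x - y) + (y - T n y) + T n (y - x).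
  by rewrite (opB (lT n)) !subrKA.
have {}xy : `|x - y| < e / 3 by move: xy; rewrite -ball_normE.
have -> : e = e / 3 + e / 3 + e / 3 by field.
apply: le_lt_trans (ler_normD _ _) _; apply: ltrD; last first.
  by apply: le_lt_trans xy; rewrite distrC !hnormE lecR.
by apply: le_lt_trans (ler_normD _ _) _; apply: ltrD.
Qed.

(** * Complete orthogonal families of projections *)

Section OrthogonalFamily.
Variable Q : nat -> H -> H.
Hypothesis Qp : forall n, orth_projection dot (Q n).
Hypothesis Qo : forall i j x, i != j -> Q i (Q j x) = 0.
Hypothesis Qc : forall x, \sum_(0 <= i < n) Q i x @[n --> \oo] --> x.

Let Ql n : linear (Q n). Proof. by have [[]] := Qp n. Qed.
Let QQ n x : Q n (Q n x) = Q n x. Proof. by have [] := Qp n. Qed.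

Lemma family_ext x y : (forall n, Q n x = Q n y) -> x = y.
Proof.
move=> xy; have := @Qc x; rewrite (_ : (fun n => _) = (fun n => \sum_(0 <= i < n) Q i y)).
  by move=> yx; apply: (cvg_unique (@norm_hausdorff _ _) yx (@Qc y)).
by apply/funext => n; apply: eq_bigr => i _; rewrite xy.
Qed.

Lemma family_ortho i j x y : i != j -> ip (Q i x) (Q j y) = 0.
Proof. by move=> ij; have [_ _ aQ] := Qp i; rewrite aQ Qo// ip0r. Qed.

Lemma family_sum_norm (v : nat -> H) m n : (forall i, Q i (v i) = v i) ->
  hnorm (\sum_(m <= i < n) v i) ^+ 2 = \sum_(m <= i < n) hnorm (v i) ^+ 2.
Proof.
move=> Qv; have [nm|] := leqP n m; first by rewrite !big_geq// hnorm0 expr0n.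
elim: n => [//|n IHn]; rewrite ltnS => mn; rewrite !big_nat_recr//=.
rewrite hnorm_pythagoras; last first.
  rewrite ipC ip_sumr rmorph_sum big1_seq//= => i.
  rewrite mem_index_iota => /andP[_ ilt].
  by rewrite -(Qv n) -(Qv i) family_ortho ?rmorph0// gtn_eqF.
by move: mn; rewrite leq_eqVlt => /orP[/eqP <-|/IHn -> //]; rewrite !big_geq// hnorm0 expr0n.
Qed.

Lemma family_proj_sum (v : nat -> H) n j : (forall i, Q i (v i) = v i) ->
  Q j (\sum_(0 <= i < n) v i) = if (j < n)%N then v j else 0.
Proof.
move=> Qv; rewrite op_sum//; under eq_bigr do rewrite -Qv.
have [jn|jn] := ltnP j n.
  rewrite (bigD1_seq j) ?mem_index_iota ?iota_uniq//= QQ Qv big1 ?addr0// => i ij.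
  by rewrite Qo// eq_sym.
rewrite big1_seq// => i; rewrite mem_index_iota => /andP[_ /andP[_ ilt]].
by rewrite Qo// gtn_eqF// (leq_trans ilt).
Qed.

Lemma family_ip x y :
  \sum_(0 <= i < n) Re (ip (Q i x) (Q i y)) @[n --> \oo] --> Re (ip x y).
Proof.
rewrite (_ : (fun n => _) = (fun n => Re (ip x (\sum_(0 <= i < n) Q i y)))).
  exact: ip_Re_cvg (@Qc y).
apply/funext => n; rewrite ip_sumr raddf_sum; apply: eq_bigr => i _.
by have [_ _ ->] := Qp i; rewrite QQ.
Qed.

Lemma family_parseval x : \sum_(0 <= i < n) hnorm (Q i x) ^+ 2 @[n --> \oo] --> hnorm x ^+ 2.
Proof.
have -> : hnorm x ^+ 2 = Re (ip x x) by rewrite ip_hnorm.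
rewrite (_ : (fun n => _) = (fun n => \sum_(0 <= i < n) Re (ip (Q i x) (Q i x)))).
  exact: family_ip.
by apply/funext => n; apply: eq_bigr => i _; rewrite ip_hnorm.
Qed.

Lemma nondecreasing_sum_sqr (v : nat -> H) :
  nondecreasing_seq (fun n => \sum_(0 <= i < n) hnorm (v i) ^+ 2).
Proof.
apply/nondecreasing_seqP => n.
by rewrite big_nat_recr//= lerDl sqr_ge0.
Qed.

Lemma family_bessel x n : \sum_(0 <= i < n) hnorm (Q i x) ^+ 2 <= hnorm x ^+ 2.
Proof.
have xP := @family_parseval x; have <- := cvg_lim (@Rhausdorff R) xP.
apply: nondecreasing_cvgn_le; first exact: nondecreasing_sum_sqr.
by apply/cvg_ex; exists (hnorm x ^+ 2).
Qed.

Lemma family_le x y : (forall n, hnorm (Q n x) <= hnorm (Q n y)) -> hnorm x <= hnorm y.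
Proof.
move=> xy; rewrite -(@ler_pXn2r _ 2)// ?nnegrE ?hnorm_ge0//.
apply: (ler_cvg_to (@family_parseval x) (@family_parseval y)).
apply: nearW => n; apply: ler_sum => i _.
by rewrite ler_pXn2r ?nnegrE ?hnorm_ge0.
Qed.

(** By Pythagoras the blocks of the series of c_i Q_i x have square norms equal to blocks of a
    bounded nondecreasing sum, so the series is Cauchy; z is its limit. *)
Lemma riesz_fischer (c : nat -> R) x B :
  (forall n, \sum_(0 <= i < n) (c i * hnorm (Q i x)) ^+ 2 <= B) ->
  exists z, forall n, Q n z = (c n)%:C *: Q n x.
Proof.
move=> cB; pose v i := (c i)%:C *: Q i x.
have Qv i : Q i (v i) = v i by rewrite opZ// QQ.
have vE i : hnorm (v i) ^+ 2 = (c i * hnorm (Q i x)) ^+ 2.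
  by rewrite hnormZr !exprMn real_normK// num_real.
pose s n := \sum_(0 <= i < n) hnorm (v i) ^+ 2.
have cs : cauchy (s n @[n --> \oo]).
  apply/cvg_cauchy/nondecreasing_is_cvgn; first exact: nondecreasing_sum_sqr.
  exists B => _ [n _ <-]; apply: le_trans (cB n).
  by rewrite /s; under eq_bigr do rewrite vE.
have /cauchy_cvg/cvg_ex[z zP] : cauchy (series v n @[n --> \oo]).
  apply/cauchy_seriesP => e e0.
  have [e' e'0 ->] : exists2 e' : R, 0 < e' & e = e'%:C.
    exists (complex.Re e); last by rewrite RRe_real// ger0_real// ltW.
    by move: e0; rewrite ltcE => /andP[].
  have := cs; rewrite -[s]/(series (fun i => hnorm (v i) ^+ 2)) => /cauchy_seriesP.
  move=> /(_ (e' ^+ 2) (exprn_gt0 _ e'0)); apply: filterS => -[m n] /=.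
  rewrite -family_sum_norm// normrX => h; rewrite hnormE ltcR.
  by move: h; rewrite ger0_norm ?hnorm_ge0// ltr_pXn2r// ?nnegrE ?hnorm_ge0 ?ltW.
exists z => j; have [_ cQ] : bounded_op (Q j) by case: (Qp j).
have Qz : Q j (series v n) @[n --> \oo] --> Q j z by exact: continuous_cvg (cQ z) zP.
apply: (cvg_unique (@norm_hausdorff _ _) Qz).
apply: (@cvg_near_cst); exists j.+1 => // n /= jn.
by rewrite /series /= family_proj_sum// jn.
Qed.

(** The vector is chosen by its components, which determine it by completeness of the family.
    [diag_projE] shows that it exists, so the default 0 is never taken, and all further properties
    are checked componentwise. *)
Definition diag_proj (b : pred nat) x : H :=
  xget 0 [set z | forall n, Q n z = if b n then Q n x else 0].

Lemma diag_projE b x n : Q n (diag_proj b x) = if b n then Q n x else 0.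
Proof.
suff [z zP] : exists z, forall n, Q n z = if b n then Q n x else 0.
  have zS : [set z | forall n, Q n z = if b n then Q n x else 0] z by exact: zP.
  exact: (xgetI 0 zS n).
have [|z zP] := @riesz_fischer (fun n => (b n)%:R) x (hnorm x ^+ 2).
  move=> m; apply: le_trans (family_bessel x m); apply: ler_sum => i _.
  by case: (b i); rewrite ?mul1r// mul0r expr0n sqr_ge0.
by exists z => m; rewrite zP; case: (b m); rewrite ?scale1r ?scale0r.
Qed.

Lemma diag_proj_linear b : linear (diag_proj b).
Proof.
move=> c x y; apply: family_ext => n; rewrite Ql !diag_projE.
by case: ifP; rewrite ?Ql// scaler0 addr0.
Qed.

Lemma diag_proj_bounded b : bounded_op (diag_proj b).
Proof.
apply: contraction_bounded; first exact: diag_proj_linear.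
move=> x; apply: family_le => n; rewrite diag_projE.
by case: ifP; rewrite ?hnorm0 ?hnorm_ge0.
Qed.

Lemma diag_projI b b' x : diag_proj b (diag_proj b' x) = diag_proj (predI b b') x.
Proof. by apply: family_ext => n; rewrite !diag_projE /=; case: (b n); case: (b' n). Qed.

Lemma diag_proj_eq b b' x : b =1 b' -> diag_proj b x = diag_proj b' x.
Proof. by move=> bb; apply: family_ext => n; rewrite !diag_projE bb. Qed.

Lemma diag_proj_adjoint b : adjoint_op dot (diag_proj b) (diag_proj b).
Proof.
have dRe x y : Re (ip (diag_proj b x) y) = Re (ip x (diag_proj b y)).
  apply: (cvg_unique (@Rhausdorff R) (@family_ip _ _)).
  rewrite (_ : (fun n => _) = (fun n => \sum_(0 <= i < n) Re (ip (Q i x) (Q i (diag_proj b y))))).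
    exact: family_ip.
  apply/funext => n; apply: eq_bigr => i _; rewrite !diag_projE.
  by case: ifP; rewrite ?ip0l ?ip0r.
move=> x y; apply: ip_Re_ext => //.
by rewrite -dRe (opZ (diag_proj_linear b)).
Qed.

Lemma diag_proj_orth b : orth_projection dot (diag_proj b).
Proof.
split; [exact: diag_proj_bounded| |exact: diag_proj_adjoint].
by move=> x; rewrite diag_projI; apply: diag_proj_eq => n /=; rewrite andbb.
Qed.

Lemma diag_proj_cvg b x :
  \sum_(0 <= i < n) (if b i then Q i x else 0) @[n --> \oo] --> diag_proj b x.
Proof.
rewrite (_ : (fun n => _) = (fun n => \sum_(0 <= i < n) Q i (diag_proj b x))); first exact: Qc.
by apply/funext => n; apply: eq_bigr => i _; rewrite diag_projE.
Qed.

Lemma diag_proj_comm b T x : linear T -> (forall n x, T (Q n x) = Q n (T x)) ->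
  T (diag_proj b x) = diag_proj b (T x).
Proof.
move=> lT TQ; apply: family_ext => n; rewrite -TQ !diag_projE.
by case: ifP => _; rewrite ?TQ// op0.
Qed.

Lemma orth_projection_comp (E F : H -> H) : orth_projection dot E -> orth_projection dot F ->
  (forall x, E (F x) = F (E x)) -> orth_projection dot (fun x => E (F x)).
Proof.
move=> [bE EE aE] [bF FF aF] EF; split.
- exact: bounded_op_comp.
- by move=> x; rewrite -EF FF EE.
- by move=> x y; rewrite aE aF EF.
Qed.

End OrthogonalFamily.

End HilbertTheory.

(** * Discrete measures on the line *)

Section AtomicMeasure.
Context {R : realType} (w : nat -> {nonneg R}) (c : nat -> R).
Local Open Scope ereal_scope.

(** This will be the scalar spectral measure of a vector, the weights being the squared norms of its
    components. *)
Definition atomic : {measure set (measurableTypeR R) -> \bar R} :=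
  mseries (fun n => mscale (w n) (dirac (c n : measurableTypeR R))) 0.

Lemma atomicE (B : set (measurableTypeR R)) : atomic B =
  \sum_(n <oo) ((w n)%:num * (`[< B (c n) >])%:R)%:E.
Proof.
rewrite /atomic /= /mseries; apply: eq_eseriesr => n _.
rewrite -[LHS]/((w n)%:num%:E * \d_(c n : measurableTypeR R) B) diracE EFinM.
by congr (_ * (_ %:R)%:E)%E.
Qed.

Lemma atomic_integral_ge0 (f : measurableTypeR R -> R) : measurable_fun setT f ->
  (forall t, (0 <= f t)%R) ->
  \int[atomic]_t (f t)%:E = \sum_(n <oo) ((w n)%:num * f (c n))%:E.
Proof.
move=> mf f0; have mf' : measurable_fun setT (fun t => (f t)%:E) by apply/measurable_EFinP.
rewrite ge0_integral_measure_series//; last by move=> t _; rewrite lee_fin.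
apply: eq_eseriesr => n _.
rewrite ge0_integral_mscale//; last by move=> t _; rewrite lee_fin.
by rewrite integral_dirac// diracT mul1e EFinM.
Qed.


Local Close Scope ereal_scope.
Local Open Scope ring_scope.

Lemma cvg_nneseries_EFin (u : nat -> R) l :
  \sum_(0 <= i < n) u i @[n --> \oo] --> l -> (\sum_(n <oo) (u n)%:E = l%:E)%E.
Proof.
move=> ul; apply/cvg_lim => //.
rewrite (_ : (fun n => _) = (EFin \o (fun n => \sum_(0 <= i < n) u i))).
  by apply: cvg_EFin; [exact: nearW|exact: ul].
by apply/funext => n; rewrite sumEFin.
Qed.

Lemma nneseries_lt_pinfty (u : nat -> R) : (forall n, 0 <= u n) ->
  ((\sum_(n <oo) (u n)%:E < +oo)%E <-> exists B, forall n, \sum_(0 <= i < n) u i <= B).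
Proof.
move=> u0; have nd : nondecreasing_seq (fun n => \sum_(0 <= i < n) u i).
  by apply/nondecreasing_seqP => n; rewrite big_nat_recr//= lerDl.
split=> [ufin|[B uB]].
  exists (fine (\sum_(n <oo) (u n)%:E)%E) => n.
  rewrite -lee_fin fineK; last first.
    by rewrite ge0_fin_numE// nneseries_ge0// => k _ _; rewrite lee_fin.
  rewrite -sumEFin; apply: nneseries_lim_ge => k _ _; by rewrite lee_fin.
have /cvg_ex[l ul] : cvgn (fun n => \sum_(0 <= i < n) u i).
  by apply: nondecreasing_is_cvgn => //; exists B => _ [n _ <-].
by rewrite (cvg_nneseries_EFin ul) ltry.
Qed.

Lemma bounded_sum_cvg (u : nat -> R) B : (forall n, 0 <= u n) ->
  (forall n, \sum_(0 <= i < n) u i <= B) ->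
  exists l : R, \sum_(0 <= i < n) u i @[n --> \oo] --> l.
Proof.
move=> u0 uB; apply/cvg_ex/nondecreasing_is_cvgn; last by exists B => _ [n _ <-].
by apply/nondecreasing_seqP => n; rewrite big_nat_recr//= lerDl.
Qed.

(** The identity function is split into its positive and negative parts. Both are dominated by 1 +
    t^2, whose integral is controlled by the two bounds, so each part has a finite integral. *)
Lemma atomic_integral_id l B :
  (forall n, \sum_(0 <= i < n) (w i)%:num * c i ^+ 2 <= B) ->
  (forall n, \sum_(0 <= i < n) (w i)%:num <= B) ->
  \sum_(0 <= i < n) (w i)%:num * c i @[n --> \oo] --> l ->
  fine (\int[atomic]_t t%:E)%E = l.
Proof.
move=> c2B wB cl; have w0 i : 0 <= (w i)%:num by [].
have part (f : measurableTypeR R -> R) : measurable_fun setT f ->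
    (forall t, 0 <= f t <= 1 + t ^+ 2) ->
    exists l' : R, (\int[atomic]_t (f t)%:E = l'%:E)%E /\
      \sum_(0 <= i < n) (w i)%:num * f (c i) @[n --> \oo] --> l'.
  move=> mf f01; have f0 t : 0 <= f t by have /andP[] := f01 t.
  have [||l' fl] := @bounded_sum_cvg (fun i => (w i)%:num * f (c i)) (B + B).
  - by move=> n; rewrite mulr_ge0.
  - move=> n; apply: le_trans (lerD (wB n) (c2B n)).
    rewrite -big_split /=; apply: ler_sum => i _.
    by rewrite -[X in X + _]mulr1 -mulrDr ler_wpM2l//; have /andP[] := f01 (c i).
  by exists l'; rewrite atomic_integral_ge0// (cvg_nneseries_EFin fl).
pose fp (t : measurableTypeR R) : R := Num.max t 0.
pose fn (t : measurableTypeR R) : R := Num.max (- t) 0.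
have [||lp [Ip cp]] := part fp.
- exact: measurable_maxr.
- by move=> t; rewrite /fp; case: (leP t 0); nra.
have [||ln [In cn]] := part fn.
- by apply: measurable_maxr => //; exact: measurable_funN.
- by move=> t; rewrite /fn; case: (leP (- t) 0); nra.
rewrite integralE.
have -> : ((fun t : R => t%:E)^\+ = fun t => (fp t)%:E)%E.
  by apply/funext => t; rewrite /fp funeposE EFin_max.
have -> : ((fun t : R => t%:E)^\- = fun t => (fn t)%:E)%E.
  by apply/funext => t; rewrite /fn funenegE EFin_max.
rewrite Ip In /=; apply: (cvg_unique (@Rhausdorff R) _ cl).
rewrite (_ : (fun n => _) = (fun n => \sum_(0 <= i < n) (w i)%:num * fp (c i)
    - \sum_(0 <= i < n) (w i)%:num * fn (c i))); first exact: cvgB.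
apply/funext => n; rewrite -sumrB; apply: eq_bigr => i _; rewrite -mulrBr; congr (_ * _).
by rewrite /fp /fn; case: (leP (c i) 0); case: (leP (- c i) 0); lra.
Qed.

End AtomicMeasure.

(** * The spectral measure of a diagonal operator *)

Section SpectralResolution.
Context {R : realType} {H : completeNormedModType R[i]}.
Variable dot : {dot H for Num.conj}.
Hypothesis hn : hilbert_norm dot.
Variable Q : nat -> H -> H.
Hypothesis Qp : forall n, orth_projection dot (Q n).
Hypothesis Qo : forall i j x, i != j -> Q i (Q j x) = 0.
Hypothesis Qc : forall x, \sum_(0 <= i < n) Q i x @[n --> \oo] --> x.
Variables (p : H -> H) (c : nat -> R) (G : set (H * H)).
Hypothesis pp : orth_projection dot p.
Hypothesis pQ : forall n x, p (Q n x) = Q n (p x).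
Hypothesis GP : forall x z, G (x, z) <-> p x = x /\ forall n, Q n z = (c n)%:C *: Q n x.
Local Notation Re := (@complex.Re R).

Definition spectral_diag (B : set R) x := diag_proj Q (fun n => `[< B (c n) >]) (p x).

Let pl : linear p. Proof. by case: pp => -[]. Qed.
Let pI x : p (p x) = p x. Proof. by case: pp. Qed.
Let Ql n : linear (Q n). Proof. by have [[]] := Qp n. Qed.

Lemma spectral_diag_orth B : orth_projection dot (spectral_diag B).
Proof.
apply: orth_projection_comp => //; first exact: diag_proj_orth.
by move=> x; rewrite (diag_proj_comm hn Qp Qo Qc).
Qed.

Definition spectral_weight x n : {nonneg R} := NngNum (sqr_ge0 (hnorm (Q n (p x)))).

Lemma spectral_diag_measure x (B : set R) : measurable (B : set (measurableTypeR R)) ->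
  atomic (spectral_weight x) c B = (Re (ip dot x (spectral_diag B x)))%:E.
Proof.
move=> _; rewrite atomicE; apply: cvg_nneseries_EFin.
have [_ EE aE] := spectral_diag_orth B.
have -> : ip dot x (spectral_diag B x) = (hnorm (spectral_diag B x) ^+ 2)%:C.
  by rewrite -[X in ip dot x X]EE -aE (ip_hnorm hn).
have := @family_parseval _ _ _ hn _ Qp Qc (spectral_diag B x) => /=.
rewrite (_ : (fun n => _) = (fun n =>
  \sum_(0 <= i < n) (spectral_weight x i)%:num * (`[< B (c i) >])%:R)) //.
apply/funext => n; apply: eq_bigr => i _; rewrite (diag_projE hn Qp Qo Qc).
by case: asboolP; rewrite ?mulr1// hnorm0 expr0n mulr0.
Qed.

(** For an operator with eigenvalue c_n on the range of p Q_n, the scalar measures are discrete and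
    can be written down directly. The Riesz-Fischer lemma matches the domain with square
    integrability, and Parseval's identity matches <x, y> with the integral of t. *)
Lemma spectral_resolution_diag : spectral_resolution dot p G spectral_diag.
Proof.
split.
- split; first by apply/GP; rewrite !op0//; split=> // n; rewrite op0// scaler0.
  move=> r x y x' y' /GP[px xy] /GP[px' xy']; apply/GP; rewrite pl px px'; split=> // n.
  by rewrite !Ql xy xy' scalerDr !scalerA mulrC.
- by move=> B _; apply: spectral_diag_orth.
- apply/funext => x; apply: (family_ext Qc) => n; rewrite (diag_projE hn Qp Qo Qc).
  by rewrite asboolT.
- move=> B C _ _ x; rewrite /spectral_diag.
  rewrite (diag_proj_comm hn Qp Qo Qc) ?pI// (diag_projI hn Qp Qo Qc).
  by apply: (diag_proj_eq hn Qp Qo Qc) => n; rewrite /= asbool_and.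
exists (fun x => atomic (spectral_weight x) c); split.
- by move=> x B mB; rewrite spectral_diag_measure.
- move=> x; have msqr : measurable_fun setT (fun t : measurableTypeR R => (t : R) ^+ 2).
    exact: measurable_funX.
  rewrite (atomic_integral_ge0 _ _ msqr (fun t => sqr_ge0 _)).
  rewrite nneseries_lt_pinfty; last by move=> n; rewrite mulr_ge0 ?sqr_ge0.
  split=> [[y /GP[px xy]]|[px [B xB]]].
    split=> //; exists (hnorm y ^+ 2) => n; apply: le_trans (family_bessel hn Qp Qc y n).
    apply: ler_sum => i _; rewrite xy hnormZr exprMn real_normK ?num_real//= px.
    by rewrite mulrC.
  have [|z zP] := @riesz_fischer _ _ _ hn _ Qp Qo c x B.
    move=> n; apply: le_trans (xB n); apply: ler_sum => i _.
    by rewrite /= px exprMn mulrC.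
  by exists z; apply/GP.
move=> x y /GP[px xy]; split.
  apply: (family_ext Qc) => n; rewrite -pQ xy (opZ pl) pQ px.
  by rewrite -xy.
have ipE i : ip dot (Q i x) (Q i y) = (hnorm (Q i x) ^+ 2 * c i)%:C.
  by rewrite xy ipZr (ip_hnorm hn) -rmorphM mulrC.
(* The required equality has a real right-hand side; <x, y> is real because each <Q_i x, Q_i y> is a
   real multiple of |Q_i x|^2. *)
have ImE : complex.Im (ip dot x y) = 0.
  have -> : complex.Im (ip dot x y) = Re (ip dot ('i *: x) y).
    by rewrite ipZl; case: (ip dot x y) => r m; rewrite /= mul0r sub0r mulN1r opprK.
  apply: (cvg_unique (@Rhausdorff R) (@family_ip _ _ _ hn _ Qp Qc ('i *: x) y)).
  rewrite (_ : (fun n => _) = fun=> 0); first exact: cvg_cst.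
  apply/funext => n; rewrite big1// => i _; rewrite (opZ (Ql i)) ipZl ipE.
  by rewrite /= mul0r mulr0 subrr.
have -> : ip dot x y = (Re (ip dot x y))%:C.
  by case: (ip dot x y) ImE => r m /= ->.
congr _%:C; apply/esym; apply: (@atomic_integral_id _ _ _ _ (hnorm y ^+ 2 + hnorm x ^+ 2)).
- move=> n; apply: le_trans (_ : _ <= hnorm y ^+ 2) _; last by rewrite lerDl sqr_ge0.
  apply: le_trans (family_bessel hn Qp Qc y n).
  apply: ler_sum => i _; rewrite xy hnormZr exprMn real_normK ?num_real//= px.
  by rewrite mulrC.
- move=> n; apply: le_trans (_ : _ <= hnorm x ^+ 2) _; last by rewrite lerDr sqr_ge0.
  by apply: le_trans (family_bessel hn Qp Qc x n); rewrite /= px.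
rewrite (_ : (fun n => _) = (fun n => \sum_(0 <= i < n) Re (ip dot (Q i x) (Q i y)))).
  exact: family_ip.
by apply/funext => n; apply: eq_bigr => i _; rewrite ipE /= px.
Qed.

End SpectralResolution.

(** * The GNS space and the spectral flow *)

Section GNS.
Context {R : realType} {A : cstarAlgType R} (s : graph_family A) (q : R) (a b : A).
Context {H : completeNormedModType R[i]} (dot : {dot H for Num.conj}).
Variables (h : {scalar A}) (Lam : {linear A -> H}) (rep : A -> H -> H).
Variables (sigma : R[i] -> {lrmorphism A -> A}) (Phi : int -> A -> A) (PhiH : int -> H -> H).
Hypothesis ab : is_CSUq2 q a b.
Hypothesis ga : is_graph_algebra s.
Hypothesis abs : suq2_graph_identification q s a b.
Hypothesis haar : is_haar_state q a b h.
Hypothesis gns : is_gns dot Lam rep h.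
Hypothesis csigma : is_circle_action s sigma.
Hypothesis fP : is_fourier_component sigma Phi.
Hypothesis PhiHP : forall m, is_extension Lam (Phi m) (PhiH m).
Local Notation ip := (ip dot).
Local Notation Re := (@complex.Re R).
Local Notation hom := (hom sigma).
Local Notation mono := (monomial s sigma).
Implicit Types (x y z : A) (u v : H) (d m : int).

Lemma graph_rel : graph_relations s. Proof. by case: ga. Qed.
Local Notation gs := graph_rel.
Lemma gns_hilbert : hilbert_norm dot. Proof. by case: gns. Qed.
Local Notation hn := gns_hilbert.
Lemma ip_Lam x y : ip (Lam x) (Lam y) = h (star x * y). Proof. by case: gns. Qed.
Lemma rep_Lam x y : rep x (Lam y) = Lam (x * y). Proof. by case: gns. Qed.
Lemma rep_bounded x : bounded_op (rep x). Proof. by case: gns. Qed.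
Lemma rep_linear x : linear (rep x). Proof. by case: (rep_bounded x). Qed.
Lemma PhiH_bounded m : bounded_op (PhiH m). Proof. by case: (PhiHP m). Qed.
Lemma PhiH_linear m : linear (PhiH m). Proof. by case: (PhiH_bounded m). Qed.

Lemma PhiH_Lam m d x : hom d x -> PhiH m (Lam x) = if d == m then Lam x else 0.
Proof.
move=> hx; have [_ ->] := PhiHP m; rewrite (fourier_component_hom m fP hx).
by case: ifP => _ //; rewrite linear0.
Qed.

Lemma hnorm_Lam x M : cnorm x < M -> hnorm (Lam x) <= M.
Proof.
move=> xM; have M0 : 0 <= M by apply: le_trans (ltW xM); apply: cnorm_ge0.
rewrite -(@ler_pXn2r _ 2)// ?nnegrE ?hnorm_ge0// -lecR -(ip_hnorm hn) ip_Lam.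
by case: haar => h0 h1 _ _; apply: state_sqr_le.
Qed.

(** Combines density of [Lam] A in [H], density of the span of monomials in A, and contractivity of
    [Lam]. *)
Lemma dense_seq u : exists2 f : nat -> A, (forall n, lspan mono (f n)) &
  Lam (f n) @[n --> \oo] --> u.
Proof.
have step (e : R) : 0 < e -> exists2 x, lspan mono x & hnorm (u - Lam x) < e.
  move=> e0; have e2 : 0 < (e / 2)%:C :> R[i] by rewrite ltcR; lra.
  case: gns => _ _ dL _ _; have [||w [/= uw [x _ xE]]] := dL (ball u (e / 2)%:C).
  - by exists u; apply: ballxx.
  - exact: ball_open.
  have [y My xy] := monomial_dense gs csigma x ga (e := e / 2) ltac:(lra).
  exists y => //; rewrite -ltcR -hnormE -(subrKA (Lam x)).
  apply: le_lt_trans (ler_normD _ _) _; rewrite [e]splitr rmorphD ltr_leD//.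
    by move: uw; rewrite -xE -ball_normE.
  by rewrite -linearB hnormE lecR hnorm_Lam.
have inv0 n : 0 < n.+1%:R^-1 :> R by rewrite invr_gt0.
exists (fun n => projT1 (cid2 (step _ (inv0 n)))).
  by move=> n; case: cid2.
apply/cvgrPdist_lt => e e0.
have [e' e'0 ->] : exists2 e' : R, 0 < e' & e = e'%:C.
  exists (Re e); last by rewrite RRe_real// ger0_real// ltW.
  by move: e0; rewrite ltcE => /andP[].
have /cvgrPdist_lt/(_ e' e'0) := @cvg_harmonic R; apply: filterS => n.
rewrite sub0r normrN ger0_norm; last by rewrite /harmonic /= ltW.
by case: cid2 => x Mx /= xn hn'; rewrite hnormE ltcR (lt_trans xn).
Qed.

(** Operator identities need checking only on monomials, which have a definite degree and on which
    [PhiH] is therefore known. *)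
Lemma op_ext (T T' : H -> H) : bounded_op T -> bounded_op T' ->
  (forall x, mono x -> T (Lam x) = T' (Lam x)) -> forall u, T u = T' u.
Proof.
move=> [lT cT] [lT' cT'] TT u; have [f Mf fu] := dense_seq u.
have Tf n : T (Lam (f n)) = T' (Lam (f n)).
  elim: (Mf n) => [|c x y Mx _ IH]; first by rewrite !linear0 !op0.
  by rewrite !linearP lT lT' IH TT.
have T1 : T (Lam (f n)) @[n --> \oo] --> T u by exact: continuous_cvg (cT u) fu.
have T2 : T' (Lam (f n)) @[n --> \oo] --> T' u by exact: continuous_cvg (cT' u) fu.
apply: (cvg_unique (@norm_hausdorff _ _) T1).
by rewrite (_ : (fun n => _) = (fun n => T' (Lam (f n))))//; apply/funext.
Qed.

Lemma adjoint_ext (T T' : H -> H) : bounded_op T -> bounded_op T' ->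
  (forall x y, mono x -> mono y -> ip (T (Lam x)) (Lam y) = ip (Lam x) (T' (Lam y))) ->
  adjoint_op dot T T'.
Proof.
move=> [lT cT] [lT' cT'] TT.
have TTs x y : lspan mono x -> lspan mono y -> ip (T (Lam x)) (Lam y) = ip (Lam x) (T' (Lam y)).
  elim=> [|c x1 x2 Mx1 _ IH] My; first by rewrite linear0 op0// !ip0l.
  rewrite linearP lT !ipDl !ipZl IH//; congr (_ * _ + _) => {x2 IH}.
  elim: My => [|c' y1 y2 My1 _ IH]; first by rewrite linear0 (op0 lT') !ip0r.
  by rewrite linearP lT' !ipDr !ipZr IH TT.
have TTr x v : lspan mono x -> ip (T (Lam x)) v = ip (Lam x) (T' v).
  move=> Mx; have [f Mf fv] := dense_seq v.
  have re z : lspan mono z -> Re (ip (T (Lam z)) v) = Re (ip (Lam z) (T' v)).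
    move=> Mz; apply: (cvg_unique (@Rhausdorff R) (ip_Re_cvg hn fv)).
    have fT : T' (Lam (f n)) @[n --> \oo] --> T' v by exact: continuous_cvg (cT' v) fv.
    have := ip_Re_cvg hn (y := Lam z) fT; apply: cvg_trans; apply: near_eq_cvg.
    by apply: nearW => n; rewrite TTs.
  apply: ip_Re_ext; first exact: re.
  by rewrite -(opZ lT) -linearZ; apply: re; apply: lspanZ.
move=> u v; have [f Mf fu] := dense_seq u.
have re w : Re (ip w (T u)) = Re (ip (T' w) u).
  have fT : T (Lam (f n)) @[n --> \oo] --> T u by exact: continuous_cvg (cT u) fu.
  apply: (cvg_unique (@Rhausdorff R) (ip_Re_cvg hn fT)).
  have := ip_Re_cvg hn (y := T' w) fu; apply: cvg_trans; apply: near_eq_cvg.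
  by apply: nearW => n; rewrite ipC [in RHS]ipC TTr.
rewrite ipC [in RHS]ipC; congr Num.conj; apply: ip_Re_ext; first exact: re.
by rewrite -(opZ lT'); apply: re.
Qed.

Lemma repM x y u : rep x (rep y u) = rep (x * y) u.
Proof.
apply: (@op_ext (fun u => rep x (rep y u)) (rep (x * y))) => [||z _].
- by apply: bounded_op_comp; apply: rep_bounded.
- exact: rep_bounded.
by rewrite !rep_Lam mulrA.
Qed.

Lemma rep0 u : rep 0 u = 0.
Proof.
apply: (@op_ext (rep 0) (fun=> 0)) => [||x _]; first exact: rep_bounded.
  exact: bounded_op0.
by rewrite rep_Lam mul0r linear0.
Qed.

Lemma rep_adjoint x : adjoint_op dot (rep x) (rep (star x)).
Proof.
apply: adjoint_ext => [||y z _ _]; [exact: rep_bounded|exact: rep_bounded|].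
by rewrite !rep_Lam !ip_Lam starM mulrA.
Qed.

(** Vectors of different degrees d and d' are orthogonal: x^* y has degree d' - d, and [h] vanishes
    in nonzero degree. *)
Lemma PhiH_adjoint m : adjoint_op dot (PhiH m) (PhiH m).
Proof.
apply: adjoint_ext => [||x y]; [exact: PhiH_bounded|exact: PhiH_bounded|].
move=> /(monomial_hom gs csigma)[d [hx _]] /(monomial_hom gs csigma)[d' [hy _]].
rewrite (PhiH_Lam m hx) (PhiH_Lam m hy).
have [<-|dd] := eqVneq d d'; first by case: ifP; rewrite ?ip0l ?ip0r.
have xy0 : ip (Lam x) (Lam y) = 0.
  rewrite ip_Lam; apply: (haar_hom_eq0 ab abs haar csigma (d := - d + d')).
    by rewrite addrC subr_eq0 eq_sym.
  by apply: homM => //; apply: (hom_star csigma).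
by case: ifP; case: ifP; rewrite ?ip0l ?ip0r ?xy0.
Qed.

Lemma PhiH_comp i j u : PhiH i (PhiH j u) = if i == j then PhiH j u else 0.
Proof.
pose T v := if i == j then PhiH j v else 0.
apply: (@op_ext (fun u => PhiH i (PhiH j u)) T) => [||x].
- by apply: bounded_op_comp; apply: PhiH_bounded.
- by rewrite /T; case: (i == j); [exact: PhiH_bounded|exact: bounded_op0].
move=> /(monomial_hom gs csigma)[d [hx _]]; rewrite /T /= (PhiH_Lam j hx).
have [dj|dj] := eqVneq d j; last by rewrite (op0 (@PhiH_linear i)); case: ifP.
by rewrite (PhiH_Lam i hx) dj eq_sym.
Qed.

Lemma PhiH_orth m : orth_projection dot (PhiH m).
Proof.
split; [exact: PhiH_bounded| |exact: PhiH_adjoint].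
by move=> u; rewrite PhiH_comp eqxx.
Qed.

Lemma rep_PhiH d x m u : hom d x -> rep x (PhiH m u) = PhiH (m + d) (rep x u).
Proof.
move=> hx; apply: (@op_ext (fun u => rep x (PhiH m u)) (fun u => PhiH (m + d) (rep x u))) => [||y].
- by apply: bounded_op_comp; [exact: rep_bounded|exact: PhiH_bounded].
- by apply: bounded_op_comp; [exact: PhiH_bounded|exact: rep_bounded].
move=> /(monomial_hom gs csigma)[d' [hy _]]; rewrite /= (PhiH_Lam m hy) rep_Lam.
rewrite (PhiH_Lam _ (homM hx hy)) (addrC m) (inj_eq (addrI d)).
by case: ifP; rewrite ?rep_Lam// op0//; apply: rep_linear.
Qed.

(** The partial sums are projections, hence contractions, and each homogeneous vector is eventually
    fixed. The exhausting finite sets are arbitrary so as to cover both the symmetric sums defining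
    D and the enumeration [enumZ]. *)
Lemma PhiH_sum_cvg (r : nat -> seq int) : (forall n, uniq (r n)) ->
  (forall d, \forall n \near \oo, d \in r n) ->
  forall u, \sum_(m <- r n) PhiH m u @[n --> \oo] --> u.
Proof.
move=> ur rd; pose T n u := \sum_(m <- r n) PhiH m u.
have lT n : linear (T n).
  move=> c u v; rewrite /T scaler_sumr -big_split /=.
  by apply: eq_bigr => m _; rewrite PhiH_linear.
apply: (@contraction_cvg _ _ T (Lam @` lspan mono)) => //.
- move=> O [u Ou] oO; have [f Mf fu] := dense_seq u.
  have /fu[N _ NO] : nbhs u O by exact: open_nbhs_nbhs.
  by exists (Lam (f N)); split; [apply: (NO N (leqnn N))|exists (f N)].
- move=> n x; apply: (proj_hnorm_le hn) => //.
    move=> u; rewrite /T [in LHS]big_seq [in RHS]big_seq; apply: eq_bigr => m mr.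
    rewrite op_sum; last exact: PhiH_linear.
    rewrite (bigD1_seq m)//= PhiH_comp eqxx big1 ?addr0// => j jm.
    by rewrite PhiH_comp eq_sym (negPf jm).
  move=> u v; rewrite ipC /T !ip_sumr rmorph_sum; apply: eq_bigr => m _.
  by rewrite /= -ipC PhiH_adjoint.
move=> _ [x Mx <-]; suff xT : \forall n \near \oo, T n (Lam x) = Lam x.
  by apply: cvg_near_cst; apply: filterS xT.
elim: Mx => [|c y z My _ IH].
  by apply: nearW => n; rewrite linear0 op0.
have [d [hy _]] := monomial_hom gs csigma My.
apply: filterS2 IH (rd d) => n zT dr; rewrite linearP lT zT; congr (_ *: _ + _).
rewrite /T (bigD1_seq d)//= (PhiH_Lam d hy) eqxx big1 ?addr0// => m md.
by rewrite (PhiH_Lam m hy) eq_sym (negPf md).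
Qed.

(** Applying the continuous [PhiH m] to the partial sums isolates one component. Conversely, if the
    components match, the partial sums for D u are the Fourier partial sums of v. *)
Lemma dirac_graphP u v : dirac_graph PhiH (u, v) <->
  forall m, PhiH m v = m%:~R *: PhiH m u.
Proof.
pose r n := [seq (i : nat)%:Z - n%:Z | i <- iota 0 n.*2.+1].
have ur n : uniq (r n).
  by rewrite map_inj_uniq ?iota_uniq// => i j; lia.
have rP d n : (d \in r n) = (`|d| <= n)%N.
  apply/mapP/idP => [[j + ->]|dn].
    by rewrite mem_iota; lia.
  exists (absz (d + n%:Z)); last by lia.
  by rewrite mem_iota; lia.
have rd d : \forall n \near \oo, d \in r n.
  by exists `|d|%N => // n /= dn; rewrite rP.
have sumE n (F : int -> H) : \sum_(i < n.*2.+1) F ((i : nat)%:Z - n%:Z) = \sum_(m <- r n) F m.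
  by rewrite /r big_map -[iota _ _]/(index_iota 0 n.*2.+1) big_mkord.
have -> : dirac_graph PhiH (u, v) =
    ((\sum_(m <- r n) m%:~R *: PhiH m u) @[n --> \oo] --> v).
  rewrite /dirac_graph /=.
  under eq_fun do rewrite (sumE _ (fun m => m%:~R *: PhiH m u)).
  by [].
split=> [cv m|mv].
  have cm : PhiH m (\sum_(j <- r n) j%:~R *: PhiH j u) @[n --> \oo] --> PhiH m v.
    exact: continuous_cvg ((PhiH_bounded m).2 v) cv.
  apply: (cvg_unique (@norm_hausdorff _ _) cm); apply: cvg_near_cst.
  apply: filterS (rd m) => n mr; rewrite op_sum; last exact: PhiH_linear.
  rewrite (bigD1_seq m) ?ur//= (opZ (@PhiH_linear m)) PhiH_comp eqxx big1 ?addr0// => j jm.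
  by rewrite (opZ (@PhiH_linear m)) PhiH_comp eq_sym (negPf jm) scaler0.
have := PhiH_sum_cvg ur rd (u := v); apply: cvg_trans; apply: near_eq_cvg.
by apply: nearW => n; apply: eq_bigr => m _; rewrite mv.
Qed.

Definition fourier_proj (n : nat) : H -> H := PhiH (enumZ n).

Lemma fourier_proj_orth n : orth_projection dot (fourier_proj n).
Proof. exact: PhiH_orth. Qed.

Lemma fourier_proj_ortho i j u : i != j -> fourier_proj i (fourier_proj j u) = 0.
Proof. by move=> ij; rewrite /fourier_proj PhiH_comp (inj_eq (can_inj enumZK)) (negPf ij). Qed.

Lemma fourier_proj_complete u : \sum_(0 <= i < n) fourier_proj i u @[n --> \oo] --> u.
Proof.
pose r n := [seq enumZ i | i <- index_iota 0 n].
have ur n : uniq (r n) by rewrite map_inj_uniq ?iota_uniq//; exact: can_inj enumZK.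
have rd d : \forall n \near \oo, d \in r n.
  exists (rankZ d).+1 => // n /= dn; apply/mapP; exists (rankZ d); last by rewrite rankZK.
  by rewrite mem_index_iota.
have := PhiH_sum_cvg ur rd (u := u); apply: cvg_trans; apply: near_eq_cvg.
by apply: nearW => n; rewrite /r big_map.
Qed.

Lemma PhiH_ext u v : (forall m, PhiH m u = PhiH m v) -> u = v.
Proof. by move=> uv; apply: (family_ext fourier_proj_complete) => n; apply: uv. Qed.

Local Notation S := (Sgen s).

(** By p_v + p_w = 1, S^n = T_n T_0^* + T~_n U_0 T~_0^*. *)
Lemma Ac_SX n : Ac s (S ^+ n).
Proof.
rewrite -[_ ^+ _]mulr1 -(pv_addpw gs) mulrDr; apply: lin_spanD; apply: lin_span_gen.
  left; exists n, 0%N; rewrite (TvecE gs) /= (pv_star gs).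
  by rewrite -mulrA (pv_idem gs).
right; exists n, 0, 0%N; rewrite (TtildeE gs) /= (pw_star gs).
by rewrite -!mulrA !(pw_idem gs).
Qed.

(** * The corner cut out by x = S^k r *)

Section Corner.
Variables (k : nat) (r : A).
Hypothesis rP : r = pv s \/ r = pw s.

Lemma r_star : star r = r.
Proof. by case: rP => ->; rewrite ?(pv_star gs) ?(pw_star gs). Qed.

Lemma r_idem : r * r = r.
Proof. by case: rP => ->; rewrite ?(pv_idem gs) ?(pw_idem gs). Qed.

Lemma r_hom : hom 0 r.
Proof. by case: rP => ->; [apply: (hom_pv gs csigma)|apply: (hom_pw gs csigma)]. Qed.

Definition xvec : A := S ^+ k * r.
Definition corner_unit : A := xvec * star xvec.

Lemma corner_unitE : corner_unit = S ^+ k * r * star S ^+ k.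
Proof. by rewrite /corner_unit /xvec starM r_star starX mulrA -(mulrA _ r r) r_idem. Qed.

Lemma xvec_hom : hom k%:Z xvec.
Proof. by rewrite -[k%:Z]addr0; apply: homM r_hom; apply: hom_SX csigma _. Qed.

Lemma corner_unit_hom : hom 0 corner_unit.
Proof. by rewrite -(subrr k%:Z); apply: homM xvec_hom (hom_star csigma xvec_hom). Qed.

Lemma corner_unit_star : star corner_unit = corner_unit.
Proof. by rewrite /corner_unit starM starK. Qed.

Lemma corner_unit_idem : corner_unit * corner_unit = corner_unit.
Proof.
rewrite !corner_unitE -!mulrA (mulrA (star S ^+ k)) (SXX1 gs) mul1r.
by rewrite (mulrA r r) r_idem.
Qed.

Local Notation p := (rep corner_unit).

Lemma p_orth : orth_projection dot p.
Proof.
split; first exact: rep_bounded.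
- by move=> u; rewrite repM corner_unit_idem.
- by move=> u v; rewrite rep_adjoint corner_unit_star.
Qed.

Lemma p_PhiH m u : p (PhiH m u) = PhiH m (p u).
Proof. by rewrite (rep_PhiH _ _ corner_unit_hom) addr0. Qed.

Lemma p_fourier_proj n u : p (fourier_proj n u) = fourier_proj n (p u).
Proof. exact: p_PhiH. Qed.

Local Notation D := (dirac_graph PhiH).

(* The path is D - t k on the corner, as x has degree k. *)
Lemma straight_pathP t u v :
  straight_path (range_mul rep xvec D) (range_conj rep xvec D) t (u, v) <->
  p u = u /\ forall m, PhiH m v = (m%:~R - t * k%:R)%:C *: PhiH m u.
Proof.
have intC (j : int) : (j%:~R : R[i]) = (j%:~R : R)%:C by rewrite rmorph_int.
have natC : (k%:Z%:~R : R) = k%:R by [].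
split=> [[y0 [y1 [[/= pu [y /dirac_graphP uy ->]] [/= _ [y' /dirac_graphP uy' ->]] ->]]]|[pu uv]].
  split=> // m; rewrite (PhiH_linear m) (opZ (@PhiH_linear m)) -p_PhiH uy.
  have -> : PhiH m (rep xvec y') = (m - k%:Z)%:~R *: PhiH m u.
    rewrite -[m in LHS](subrK k%:Z) -(rep_PhiH _ _ xvec_hom) uy' (opZ (@rep_linear _)).
    by rewrite (rep_PhiH _ _ xvec_hom) subrK repM -/corner_unit pu.
  rewrite (opZ (@rep_linear _)) p_PhiH pu !scalerA -scalerDl; congr (_ *: _).
  by rewrite !intC -!rmorphM -rmorphD /= rmorphB /= natC; congr _%:C; ring.
have pv' : p v = v.
  by apply: PhiH_ext => m; rewrite -p_PhiH uv (opZ (@rep_linear _)) p_PhiH pu.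
(* Solving v = (D - t k) u: y0 is D u and y1 is (D - k) u, the values at u of the two ends of the
   path. *)
pose y0 := v + (t * k%:R)%:C *: u; pose y1 := y0 - (k%:R)%:C *: u.
have y0m m : PhiH m y0 = m%:~R *: PhiH m u.
  rewrite /y0 (opD (@PhiH_linear m)) (opZ (@PhiH_linear m)) uv -scalerDl -rmorphD.
  by rewrite /= subrK intC.
have y1m m : PhiH m y1 = (m - k%:Z)%:~R *: PhiH m u.
  rewrite /y1 (opB (@PhiH_linear m)) (opZ (@PhiH_linear m)) y0m -scalerBl.
  by rewrite !intC -rmorphB /= [in RHS]rmorphB.
have py0 : p y0 = y0 by rewrite (opD (@rep_linear _)) (opZ (@rep_linear _)) pv' pu.
have py1 : p y1 = y1 by rewrite (opB (@rep_linear _)) (opZ (@rep_linear _)) py0 pu.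
exists y0, y1; split.
- by split=> //=; exists y0 => //; apply/dirac_graphP.
- split=> //=; exists (rep (star xvec) y1); last by rewrite repM.
  apply/dirac_graphP => m; have hx := hom_star csigma xvec_hom.
  rewrite -{1 3}[m](addrK k%:Z) -!(rep_PhiH _ _ hx) y1m addrK (opZ (@rep_linear _)).
  by [].
rewrite /= /y1 scalerBr addrA -scalerDl -rmorphD subrK scale1r scalerA -rmorphM.
by rewrite /y0 addrK.
Qed.

(** Every projection of the argument has this form, so that identities between them reduce to
    Boolean identities between sets of degrees. *)
Definition corner_proj (beta : pred int) u : H :=
  diag_proj fourier_proj (fun n => beta (enumZ n)) (p u).

Lemma PhiH_corner_proj beta m u : PhiH m (corner_proj beta u) = if beta m then PhiH m (p u) else 0.
Proof.
have := diag_projE hn fourier_proj_orth fourier_proj_ortho fourier_proj_complete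
  (fun n => beta (enumZ n)) (p u) (rankZ m).
by rewrite /fourier_proj rankZK.
Qed.

Lemma corner_proj_orth beta : orth_projection dot (corner_proj beta).
Proof.
apply: orth_projection_comp; [|exact: p_orth|].
  exact: (diag_proj_orth hn fourier_proj_orth fourier_proj_ortho fourier_proj_complete).
move=> u; rewrite (diag_proj_comm hn fourier_proj_orth fourier_proj_ortho fourier_proj_complete)//.
  exact: rep_linear.
exact: p_fourier_proj.
Qed.

Lemma corner_proj_linear beta : linear (corner_proj beta).
Proof. by case: (corner_proj_orth beta) => -[]. Qed.

Lemma p_corner_proj beta u : p (corner_proj beta u) = corner_proj beta u.
Proof.
have [_ pI _] := p_orth; apply: PhiH_ext => m; rewrite -p_PhiH !PhiH_corner_proj.
by case: ifP => _; rewrite ?(op0 (@rep_linear _))// -p_PhiH pI.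
Qed.

Lemma corner_proj_p beta u : corner_proj beta (p u) = corner_proj beta u.
Proof. by rewrite /corner_proj; have [_ -> _] := p_orth. Qed.

Lemma corner_proj_comp beta beta' u :
  corner_proj beta (corner_proj beta' u) = corner_proj (predI beta beta') u.
Proof.
apply: PhiH_ext => m; rewrite !PhiH_corner_proj /= p_corner_proj PhiH_corner_proj.
by case: (beta m); case: (beta' m).
Qed.

Lemma corner_proj_sub beta beta' u :
  corner_proj beta u - corner_proj beta' u =
  corner_proj (predD beta beta') u - corner_proj (predD beta' beta) u.
Proof.
apply: PhiH_ext => m; rewrite !(opB (@PhiH_linear m)) !PhiH_corner_proj /=.
by case: (beta m); case: (beta' m); rewrite ?subrr ?subr0.
Qed.

Lemma corner_proj_eq beta beta' u : beta =1 beta' -> corner_proj beta u = corner_proj beta' u.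
Proof. by move=> bb; apply: PhiH_ext => m; rewrite !PhiH_corner_proj bb. Qed.

Lemma corner_proj_Lam beta d y : hom d y ->
  corner_proj beta (Lam y) = if beta d then Lam (corner_unit * y) else 0.
Proof.
move=> hy; apply: PhiH_ext => m; rewrite PhiH_corner_proj rep_Lam.
have hcy : hom d (corner_unit * y) by rewrite -[d]add0r; apply: homM => //; apply: corner_unit_hom.
rewrite (PhiH_Lam m hcy); have [dm|dm] := eqVneq d m.
  by rewrite -dm; case: (beta d); rewrite ?(PhiH_Lam d hcy) ?eqxx ?(op0 (@PhiH_linear d)).
case: (beta d); rewrite ?(PhiH_Lam m hcy) ?(op0 (@PhiH_linear m)) ?(negPf dm).
  by case: ifP.
by case: ifP.
Qed.

(** The operator p Phi_m is Theta_{y, z} with z = S^m, or zero. Indeed y Phi_0 S^{*m} = y S^{*m}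
    Phi_m, so it is enough that y S^{*m} agrees with p on vectors of degree m. For m <= k take y =
    S^k r S^{*(k-m)}. For m > k insert S^m S^{*m}, which fixes vectors of degree m: p Phi_m becomes
    S^m S^{*m} Phi_m if r = p_v, and 0 if r = p_w, because p_w S = 0. *)
Lemma corner_member m T : 0 <= m -> commutant (EndF00 s Lam Phi) T ->
  forall u, T (PhiH m (p u)) = PhiH m (p (T u)).
Proof.
case: m => // m _ [bT TE] u; rewrite -!p_PhiH.
have theta y z : Ac s y -> Ac s z ->
    forall u, T (rep y (PhiH 0 (rep (star z) u))) = rep y (PhiH 0 (rep (star z) (T u))).
  move=> Ay Az; apply: (TE (fun u => rep y (PhiH 0 (rep (star z) u)))).
  apply: lin_span_gen; exists y, z; split=> //; split.
    apply: bounded_op_comp; first exact: rep_bounded.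
    by apply: bounded_op_comp; [exact: PhiH_bounded|exact: rep_bounded].
  by move=> x; have [_ PL] := PhiHP 0; rewrite rep_Lam PL rep_Lam.
have thetaE y v : rep y (PhiH 0 (rep (star (S ^+ m)) v)) = rep (y * star S ^+ m) (PhiH m%:Z v).
  rewrite -(subrr m%:Z) -(rep_PhiH _ _ (hom_star csigma (hom_SX csigma m))).
  by rewrite repM starX.
have ySE y : y * star S ^+ m = corner_unit -> Ac s y -> T (p (PhiH m u)) = p (PhiH m (T u)).
  by move=> <- Ay; rewrite -!thetaE theta//; apply: Ac_SX.
have [mk|km] := leqP m k.
  apply: (ySE (S ^+ k * r * star S ^+ (k - m))).
    by rewrite -mulrA -exprD subnK// corner_unitE.
  apply: lin_span_gen; case: rP => ->.
    left; exists k, (k - m)%N; rewrite !(TvecE gs) starM (pv_star gs) starX.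
    by rewrite mulrA -(mulrA _ (pv s) (pv s)) (pv_idem gs).
  right; exists k, 0, (k - m)%N; rewrite !(TtildeE gs) starM (pw_star gs) starX /=.
  by rewrite -!mulrA !(mulrA (pw s) (pw s)) (pw_idem gs) (mulrA (pw s)) (pw_idem gs).
have SSm v : rep (S ^+ m * star S ^+ m) (PhiH m v) = PhiH m v.
  apply: (@op_ext (fun v => rep (S ^+ m * star S ^+ m) (PhiH m v)) (PhiH m)) => [||x].
  - by apply: bounded_op_comp; [exact: rep_bounded|exact: PhiH_bounded].
  - exact: PhiH_bounded.
  move=> /(monomial_hom gs csigma)[d [hx xm]]; rewrite (PhiH_Lam m hx).
  by case: eqP => [dm|_]; rewrite ?rep_Lam ?xm ?dm// op0//; apply: rep_linear.
have pm v : p (PhiH m v) = rep (S ^+ k * (r * S ^+ (m - k)) * star S ^+ m) (PhiH m v).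
  rewrite -{1}SSm repM corner_unitE; congr (rep _ _).
  by rewrite -(SstarX_S gs (ltnW km)) !mulrA.
have [j mE] : exists j, (m - k)%N = j.+1.
  by exists (m - k).-1; rewrite prednK// subn_gt0.
case: rP => rE.
  have rS : r * S ^+ (m - k) = S ^+ (m - k) by rewrite rE mE exprS mulrA (pvS gs).
  rewrite !pm rS -exprD subnKC; last exact: ltnW.
  by rewrite -!thetaE theta//; apply: Ac_SX.
have rS : r * S ^+ (m - k) = 0 by rewrite rE mE exprS mulrA (pwS gs) mul0r.
by rewrite !pm rS mulr0 mul0r !rep0 op0//; case: bT.
Qed.

Local Notation N := (corner (bicommutant (EndF00 s Lam Phi)) p).
Local Notation tau := (htilde dot s Lam).

(** A bicommutant is closed under strong limits, and for nonnegative degrees each term of the sum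
    commutes with the commutant by [corner_member]. *)
Lemma corner_proj_corner (beta : pred int) : (forall m, beta m -> 0 <= m) -> N (corner_proj beta).
Proof.
move=> b0; split; last by move=> u; rewrite corner_proj_p p_corner_proj.
split; first by case: (corner_proj_orth beta).
move=> T cT u; have [[lT cTT] _] := cT.
have Pcvg v : \sum_(0 <= i < n) (if beta (enumZ i) then fourier_proj i (p v) else 0)
    @[n --> \oo] --> corner_proj beta v.
  exact: (diag_proj_cvg hn fourier_proj_orth fourier_proj_ortho fourier_proj_complete).
have T1 : T (\sum_(0 <= i < n) (if beta (enumZ i) then fourier_proj i (p u) else 0)) @[n --> \oo]
    --> T (corner_proj beta u).
  exact: continuous_cvg (cTT (corner_proj beta u)) (@Pcvg u).
apply/esym; apply: (cvg_unique (@norm_hausdorff _ _) T1).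
have := @Pcvg (T u); apply: cvg_trans; apply: near_eq_cvg.
apply: nearW => n; rewrite op_sum//; apply: eq_bigr => i _.
by case: ifP => [/b0 e0|_]; rewrite ?op0// /fourier_proj (corner_member e0 cT).
Qed.

Lemma corner_sub T U : N T -> N U -> N (fun u => T u - U u).
Proof.
move=> [[bT cT] pT] [[bU cU] pU]; split; last first.
  by move=> u; rewrite (opB (@rep_linear _)) pT pU.
split=> [|W cW u]; first exact: bounded_op_sub.
have [[lW _] _] := cW.
by rewrite (cT W cW) (cU W cW) opB.
Qed.

Definition corner_weight i : R := Re (h (S ^+ i * r * star S ^+ i)).

Lemma star_S_corner j : (j < k)%N ->
  star (S ^+ j) * corner_unit * S ^+ j = S ^+ (k - j) * r * star S ^+ (k - j).
Proof.
move=> jk; rewrite corner_unitE starX !mulrA (SstarX_S gs (ltnW jk)).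
by rewrite -!mulrA (SstarX_Sstar gs (ltnW jk)).
Qed.

(** A vector of degree d contributes only if [beta d], so the adjoints, of negative degree, drop
    out. Of the rest, T~_j gives 0 by p_w S = 0, and T_j gives [corner_weight (k - j)]: its p_v is
    absorbed by S^{k-j} because j < k. The vector 1 supplies j = 0. *)
Lemma htilde_corner_proj (beta : pred int) : (0 < k)%N -> (forall m, beta m -> 0 <= m < k%:Z) ->
  tau (corner_proj beta) =
  (\sum_(j < k) (if beta (j : nat)%:Z then corner_weight (k - j) else 0))%:E.
Proof.
move=> k0 bk; rewrite /htilde.
pose F (j : nat) := if beta j%:Z then corner_weight (k - j) else 0.
have F0 j : (k <= j)%N -> F j = 0.
  by move=> kj; rewrite /F; case: ifP => // /bk; lia.
have Tval c (j : nat) : hom j%:Z (S ^+ j * c) -> star c = c ->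
    Re (ip (Lam (S ^+ j * c)) (corner_proj beta (Lam (S ^+ j * c)))) =
    if beta j%:Z then Re (h (c * (S ^+ (k - j) * r * star S ^+ (k - j)) * c)) else 0.
  move=> hj sc; rewrite (corner_proj_Lam beta hj); case: ifP => [bj|_]; last by rewrite ip0r.
  rewrite ip_Lam starM sc -star_S_corner; last by have := bk _ bj; lia.
  by rewrite !mulrA.
have term0 : Re (ip (Lam 1) (corner_proj beta (Lam 1))) = F 0%N.
  rewrite (corner_proj_Lam beta (hom1 sigma)) /F; case: ifP => _; last by rewrite ip0r.
  by rewrite ip_Lam star1 mul1r mulr1 corner_unitE subn0.
have pvF j : (0 < j)%N -> Re (ip (Lam (Tvec s j)) (corner_proj beta (Lam (Tvec s j)))) = F j.
  move=> j0; rewrite (TvecE gs) Tval ?(pv_star gs)//; last first.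
    by rewrite -[j%:Z]addr0; apply: homM (hom_pv gs csigma); apply: hom_SX csigma _.
  rewrite /F; case: ifP => // /bk jk; rewrite /corner_weight.
  have -> : (k - j)%N = (k - j).-1.+1 by rewrite prednK// subn_gt0; lia.
  have Spv : star S * pv s = star S by rewrite -(pv_star gs) -starM (pvS gs).
  by rewrite exprS [star S ^+ _]exprSr !mulrA (pvS gs) -(mulrA _ (star S) (pv s)) Spv.
have pwF j : (0 < j)%N -> Re (ip (Lam (Ttilde s j)) (corner_proj beta (Lam (Ttilde s j)))) = 0.
  move=> j0; rewrite (TtildeE gs) Tval ?(pw_star gs)//; last first.
    by rewrite -[j%:Z]addr0; apply: homM (hom_pw gs csigma); apply: hom_SX csigma _.
  case: ifP => // /bk jk.
  have -> : (k - j)%N = (k - j).-1.+1 by rewrite prednK// subn_gt0; lia.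
  by rewrite exprS !mulrA (pwS gs) !mul0r linear0.
have starF x (j : nat) : (0 < j)%N -> hom j%:Z x ->
    Re (ip (Lam (star x)) (corner_proj beta (Lam (star x)))) = 0.
  move=> j0 hx; rewrite (corner_proj_Lam beta (hom_star csigma hx)).
  by case: ifP => [/bk|_]; [lia|rewrite ip0r].
have hT j : hom j%:Z (Tvec s j).
  by rewrite (TvecE gs) -[j%:Z]addr0; apply: homM (hom_pv gs csigma); apply: hom_SX csigma _.
have hTt j : hom j%:Z (Ttilde s j).
  by rewrite (TtildeE gs) -[j%:Z]addr0; apply: homM (hom_pw gs csigma); apply: hom_SX csigma _.
pose g y : R := Re (ip (Lam y) (corner_proj beta (Lam y))).
pose u j := g (Tvec s j) + g (Ttilde s j) + g (star (Tvec s j)) + g (star (Ttilde s j)).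
have uF j : (0 < j)%N -> u j = F j.
  move=> j0; by rewrite /u /g pvF// pwF// (starF _ _ j0 (hT j)) (starF _ _ j0 (hTt j)) !addr0.
rewrite term0 -[X in (_ + X)%E]/(\sum_(1 <= j <oo) (u j)%:E)%E.
rewrite (@eseries_eventually0 _ u 1 k)//; last first.
  by move=> j kj; rewrite uF ?F0// (leq_trans k0).
rewrite -EFinD; congr _%:E; rewrite -[RHS](big_mkord xpredT F) [in RHS]big_ltn//; congr (_ + _).
by rewrite [LHS]big_nat_cond [RHS]big_nat_cond; apply: eq_bigr => j /andP[/andP[/uF]].
Qed.

Lemma htilde0 : tau (fun=> 0) = 0%E.
Proof.
rewrite /htilde !ip0r /= add0e; apply: eseries0 => j _ _.
by rewrite !ip0r /= !adde0.
Qed.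

(** * The projections along the path and their index *)

Definition nonneg_index t : pred int := fun m => `[< 0 <= m%:~R - t * k%:R :> R >].

Lemma nonneg_spectral_projection_path t :
  nonneg_spectral_projection dot p
    (straight_path (range_mul rep xvec (dirac_graph PhiH))
       (range_conj rep xvec (dirac_graph PhiH)) t) (corner_proj (nonneg_index t)).
Proof.
pose c n : R := (enumZ n)%:~R - t * k%:R.
exists (spectral_diag fourier_proj p c) => //.
apply: (spectral_resolution_diag hn fourier_proj_orth fourier_proj_ortho
  fourier_proj_complete p_orth p_fourier_proj) => u v.
rewrite straight_pathP; split=> -[pu uv]; split=> // n; first exact: uv.
by have := uv (rankZ n); rewrite /fourier_proj /c rankZK.
Qed.

Lemma nonneg_index_ge0 t m : 0 <= t -> nonneg_index t m -> 0 <= m.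
Proof.
move=> t0 /asboolP; rewrite subr_ge0 => tm; rewrite -(ler0z R).
by apply: le_trans tm; rewrite mulr_ge0.
Qed.

(** Together with [nonneg_index_ge0]: for two parameters in [0, 1] the index sets differ only within
    0, ..., k - 1, where the trace is finite. *)
Lemma nonneg_index_lt t m : t <= 1 -> ~~ nonneg_index t m -> m < k%:Z.
Proof.
move=> t1 /asboolPn; rewrite subr_ge0 => /negP; rewrite -ltNge => mt.
rewrite -(ltr_int R); apply: lt_le_trans mt _.
by rewrite ler_piMl.
Qed.

Lemma corner_proj_diff_tau_compact t t' : (0 < k)%N -> 0 <= t <= 1 -> 0 <= t' <= 1 ->
  tau_compact dot N tau (fun u => corner_proj (nonneg_index t) u - corner_proj (nonneg_index t') u).
Proof.
move=> k0 /andP[t0 t1] /andP[t'0 t'1]; split.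
  by apply: corner_sub; apply: corner_proj_corner => m; apply: nonneg_index_ge0.
(* The approximation is exact: after the common part cancels, the difference is one finite-trace
   projection minus another. *)
move=> e e0; pose B (i : 'I_2) : pred int :=
  if val i == 0%N then predD (nonneg_index t) (nonneg_index t')
  else predD (nonneg_index t') (nonneg_index t).
exists 2%N, (fun i => if val i == 0%N then 1 else -1), (fun i => corner_proj (B i)); split.
  move=> i; have Bk m : B i m -> 0 <= m < k%:Z.
    rewrite /B; case: ifP => _ /= /andP[].
      by move=> /(nonneg_index_lt t'1) -> /(nonneg_index_ge0 t0) ->.
    by move=> /(nonneg_index_lt t1) -> /(nonneg_index_ge0 t'0) ->.
  split; first exact: corner_proj_orth.
    by apply: corner_proj_corner => m /Bk/andP[].
  by rewrite htilde_corner_proj// ltry.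
move=> u; rewrite !big_ord_recl big_ord0 addr0 /= /B /= scale1r scaleN1r.
by rewrite -corner_proj_sub subrr normr0 mulr_ge0// ler0c ltW.
Qed.

Lemma index_val : (0 < k)%N ->
  tau (corner_proj (predD (nonneg_index 0) (nonneg_index 1))) =
  (\sum_(j < k) corner_weight (k - j))%:E.
Proof.
move=> k0; rewrite htilde_corner_proj//; last first.
  move=> m /= /andP[m1 m0]; rewrite (nonneg_index_ge0 (lexx 0) m0).
  by rewrite (nonneg_index_lt (lexx 1) m1).
congr _%:E; apply: eq_bigr => j _; rewrite ifT//= /nonneg_index mul0r subr0 mul1r.
apply/andP; split; last by apply/asboolP.
by apply/asboolPn; rewrite subr_ge0 ler_nat; apply/negP; rewrite -ltnNge.
Qed.

(** As P_1 <= P_0, the operator P_0 P_1 is P_1 itself: injective on its initial space, with cokernel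
    the range of P_0 - P_1. The projection of finite cotrace inside its range is again P_1. *)
Lemma BF_index_corner_proj : (0 < k)%N ->
  BF_index dot N tau (corner_proj (nonneg_index 0)) (corner_proj (nonneg_index 1))
    (fun u => corner_proj (nonneg_index 0) (corner_proj (nonneg_index 1) u))
    (- \sum_(j < k) corner_weight (k - j)).
Proof.
move=> k0; set P0 := corner_proj (nonneg_index 0); set P1 := corner_proj (nonneg_index 1).
have i10 m : nonneg_index 1 m -> nonneg_index 0 m.
  move=> /asboolP m1; apply/asboolP; rewrite mul0r subr0.
  by apply: le_trans m1 _; rewrite mul1r gerBl.
have P01 u : P0 (P1 u) = P1 u.
  rewrite /P0 /P1 corner_proj_comp; apply: corner_proj_eq => m /=.
  by case: (boolP (nonneg_index 1 m)) => [/i10 ->//|_]; rewrite andbF.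
have P10 u : P1 (P0 u) = P1 u.
  rewrite /P0 /P1 corner_proj_comp; apply: corner_proj_eq => m /=.
  by case: (boolP (nonneg_index 1 m)) => [/i10 ->//|_]; rewrite ?andbF.
have P0l : linear P0 by exact: corner_proj_linear.
have P1l : linear P1 by exact: corner_proj_linear.
have TE : (fun u => P0 (P1 u)) = P1 by apply/funext.
have N0 : N P0 by apply: corner_proj_corner => m; apply: nonneg_index_ge0.
have N1 : N P1 by apply: corner_proj_corner => m; apply: nonneg_index_ge0.
have O0 : orth_projection dot P0 by exact: corner_proj_orth.
have O1 : orth_projection dot P1 by exact: corner_proj_orth.
have [_ P00 _] := O0; have [_ P11 a11] := O1.
pose Dif := corner_proj (predD (nonneg_index 0) (nonneg_index 1)).
have DifE u : P0 u - P1 u = Dif u.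
  rewrite /P0 /P1 corner_proj_sub -[RHS]subr0; congr (_ - _).
  apply: PhiH_ext => m; rewrite PhiH_corner_proj op0; last exact: PhiH_linear.
  by rewrite /=; case: (boolP (nonneg_index 1 m)) => [/i10 ->//|_]; rewrite ?andbF.
have tD : tau Dif = (\sum_(j < k) corner_weight (k - j))%:E by exact: index_val.
have DifEf : (fun u => P0 u - P1 u) = Dif by apply/funext.
rewrite TE; split; first by [].
- by split=> // u; rewrite P11 P01.
- exists P1; split=> //; first by rewrite DifEf tD ltry.
exists P1, (fun=> 0), Dif; split=> //.
- split.
    have [[b1 c1] p1] := N1.
    split=> [|u]; last by rewrite !(op0 (@rep_linear _)).
    split=> [|T [[lT _] _] u]; [exact: bounded_op0|by rewrite op0].
  split.
    split=> [||u v]; [exact: bounded_op0|by []|by rewrite ip0l ip0r].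
  apply/seteqP; split=> [_ [u _ <-]|u [Pu u0]].
    by split=> //; rewrite (op0 P1l).
  by exists 0; rewrite // -[RHS]Pu u0.
- split.
    by apply: corner_proj_corner => m /andP[_]; apply: nonneg_index_ge0.
  split; first exact: corner_proj_orth.
  apply/seteqP; split=> [_ [u _ <-]|u [/= u0 u1]]; last first.
    by exists u => //; rewrite -DifE u0 u1 subr0.
  by rewrite /= -DifE (opB P0l) (opB P1l) P00 P01 P10 P11 subrr.
- by rewrite htilde0 tD !ltry.
by rewrite htilde0 tD sub0r.
Qed.

Lemma spectral_flow_corner : (0 < k)%N ->
  spectral_flow dot N tau p (range_mul rep xvec (dirac_graph PhiH))
    (range_conj rep xvec (dirac_graph PhiH)) (- \sum_(j < k) corner_weight (k - j)).
Proof.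
move=> k0; exists (fun t => corner_proj (nonneg_index t)); split.
  move=> t /andP[t0 _]; split; first exact: nonneg_spectral_projection_path.
  by apply: corner_proj_corner => m; apply: nonneg_index_ge0.
exists 1%N, (fun i => i%:R), (fun=> - \sum_(j < k) corner_weight (k - j)); split=> //.
- by move=> [|//] _.
- move=> [|//] _ t t' t01 t'01.
  (* The compact correction is the whole difference, so the distance in the quotient is 0. *)
  exists (fun u => corner_proj (nonneg_index t) u - corner_proj (nonneg_index t') u); split.
    exact: corner_proj_diff_tau_compact.
  by exists 0 => // u; rewrite subrr normr0 mul0r.
- by move=> [|//] _; apply: BF_index_corner_proj.
by rewrite big_ord1.
Qed.

End Corner.

End GNS.

(** The exponents k - j run over k, ..., 1 and never reach 0, whence the factor q^2. *)
Lemma geometric_weight_sum {R : realType} (q : R) c k : 0 < q < 1 ->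
  \sum_(j < k) c * q ^+ (2 * (k - j)) = c * q ^+ 2 * qint q k.
Proof.
move=> /andP[q0 q1]; have q2 : 1 - q ^+ 2 != 0.
  by rewrite subr_eq0 gt_eqF// exprn_ilt1// ltW.
elim: k => [|k IHk]; first by rewrite big_ord0 /qint muln0 subrr mul0r mulr0.
rewrite big_ord_recl subn0; under eq_bigr do rewrite subSS.
by rewrite IHk /qint mulnS exprD; field.
Qed.

Theorem mainTheorem4 (R : realType) (q : R) (k : nat)
    (A : cstarAlgType R) (a b : A) (s : graph_family A) (h : {scalar A})
    (H : completeNormedModType R[i]) (dot : {dot H for Num.conj})
    (Lam : {linear A -> H}) (rep : A -> H -> H)
    (sigma : R[i] -> {lrmorphism A -> A})
    (Phi : int -> A -> A) (PhiH : int -> H -> H) :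
  0 < q < 1 -> (1 <= k)%N ->
  is_CSUq2 q a b ->
  is_graph_algebra s ->
  suq2_graph_identification q s a b ->
  is_haar_state q a b h ->
  is_gns dot Lam rep h ->
  is_circle_action s sigma ->
  is_fourier_component sigma Phi ->
  (forall m, is_extension Lam (Phi m) (PhiH m)) ->
  let D := dirac_graph PhiH in
  let N := bicommutant (EndF00 s Lam Phi) in
  let sf (x : A) (D0 D1 : set (H * H)) (r : R) :=
    let p := rep (x * star x) in
    spectral_flow dot (corner N p) (htilde dot s Lam) p D0 D1 r in
  sf (Tvec s k) (range_mul rep (Tvec s k) D) (range_conj rep (Tvec s k) D)
    (- (q ^+ 4 * qint q k)) /\
  sf (Ttilde s k) (range_mul rep (Ttilde s k) D) (range_conj rep (Ttilde s k) D)
    (- (q ^+ 2 * (1 - q ^+ 2) * qint q k)).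
Proof.
move=> q01 k0 ab ga abs haar gns csigma fP PhiHP D N sf.
have gs : graph_relations s by case: ga.
have flow r : r = pv s \/ r = pw s ->
    sf (Sgen s ^+ k * r) (range_mul rep (Sgen s ^+ k * r) D)
      (range_conj rep (Sgen s ^+ k * r) D) (- \sum_(j < k) corner_weight s h r (k - j)).
  move=> rP; exact: (spectral_flow_corner ab ga abs haar gns csigma fP PhiHP rP k0).
(* Since p_v = S S^*, the weight is h(S^{i+1} S^{*(i+1)}); the shift by one adds a factor q^2 and
   accounts for q^4. *)
have pv_weight i : corner_weight s h (pv s) i = q ^+ 2 * q ^+ (2 * i).
  rewrite /corner_weight -(SSpv gs) !mulrA -mulrA -exprSr -exprS.
  by rewrite (haar_SX q01 gs ab abs haar) mulnS exprD.
have pw_weight i : corner_weight s h (pw s) i = (1 - q ^+ 2) * q ^+ (2 * i).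
  by rewrite -(haar_corner_val q01 gs ab abs haar).
rewrite (TvecE gs) (TtildeE gs); split.
  have -> : q ^+ 4 * qint q k = \sum_(j < k) corner_weight s h (pv s) (k - j).
    under eq_bigr do rewrite pv_weight.
    by rewrite geometric_weight_sum// -exprD.
  by apply: flow; left.
have -> : q ^+ 2 * (1 - q ^+ 2) * qint q k = \sum_(j < k) corner_weight s h (pw s) (k - j).
  under eq_bigr do rewrite pw_weight.
  by rewrite geometric_weight_sum// [q ^+ 2 * _]mulrC.
by apply: flow; right.
Qed.
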